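(* Let $\Lambda$ be a ring, let $\mathbf{C}:\cdots\to C_{n+1}\xrightarrow{d_{n+1}}C_n\xrightarrow{d_n}C_{n-1}\to\cdots$ be a complex of flat right $\Lambda$-modules, and let $n$ be an integer. Write $H_n(\mathbf{C}\otimes-)$ for the functor $M\mapsto H_n(\mathbf{C}\otimes_\Lambda M)$ from left $\Lambda$-modules to abelian groups. Then the left fundamental sequence of $H_n(\mathbf{C}\otimes-)$ is exact and of the form $$\cdots\to\mathrm{Tor}_3(C_n/B_n,-)\to\mathrm{Tor}_4(C_{n-1}/B_{n-1},-)\to\mathrm{Tor}_2(H_n(\mathbf{C}),-)\to\mathrm{Tor}_2(C_n/B_n,-)\to\mathrm{Tor}_3(C_{n-1}/B_{n-1},-)\to\mathrm{Tor}_1(H_n(\mathbf{C}),-)\to\mathrm{Tor}_1(C_n/B_n,-)\to\mathrm{Tor}_2(C_{n-1}/B_{n-1},-)\to H_n(\mathbf{C})\otimes-\to H_n(\mathbf{C}\otimes-)\to\mathrm{Tor}_1(C_{n-1}/B_{n-1},-)\to0,$$ i.e., with $F=H_n(\mathbf{C}\otimes-)$, its terms are identified via natural isomorphisms $\underline{F}\circ\Omega^i\simeq\mathrm{Tor}_{i+1}^\Lambda(C_{n-1}/B_{n-1},-)$ and $L_iF\simeq\mathrm{Tor}_i^\Lambda(H_n(\mathbf{C}),-)$ for $i\ge0$, and $S_iF\simeq\mathrm{Tor}_i^\Lambda(C_n/B_n,-)$ for $i\ge1$.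
   Context: Tensor products are over $\Lambda$; $B_k=\mathrm{Im}\,d_{k+1}$ denotes the boundaries of $\mathbf{C}$. Left fundamental sequence of an additive covariant functor $F$ from left $\Lambda$-modules to abelian groups. For a module $B$ choose a projective resolution $\cdots\to P_1\xrightarrow{\partial_1}P_0\to B\to0$. Put $\Omega^0B=B$, let $e_0:P_0\to B$ be the given epimorphism, and for $i\ge0$ let $m_i:\Omega^{i+1}B\to P_i$ be the kernel of $e_i:P_i\to\Omega^iB$ and $e_{i+1}:P_{i+1}\to\Omega^{i+1}B$ the epimorphism with $\partial_{i+1}=m_ie_{i+1}$. Define $L_iF(B)=\mathrm{Ker}\,F(\partial_i)/\mathrm{Im}\,F(\partial_{i+1})$ (with $\mathrm{Ker}\,F(\partial_0):=F(P_0)$); the quot-stabilization $\underline{F}(B)=\mathrm{Coker}(F(e_0):F(P_0)\to F(B))$, so that $(\underline{F}\circ\Omega^i)(B)=\underline{F}(\Omega^iB)=\mathrm{Coker}\,F(e_i)$ (well defined since $\underline{F}$ vanishes on projectives); the left satellites $S_0F=F$ and $S_iF(B)=\mathrm{Ker}(F(m_{i-1}):F(\Omega^iB)\to F(P_{i-1}))$ for $i\ge1$. The left fundamental sequence of $F$ is the sequence of functors $$\cdots\to L_2F\to S_2F\to\underline{F}\circ\Omega^2\to L_1F\to S_1F\to\underline{F}\circ\Omega\to L_0F\to F\to\underline{F}\to0$$ with maps, for $i\ge0$: $L_iF(B)\to S_iF(B)$ induced by $F(e_i)$; $S_iF(B)\to\underline{F}(\Omega^iB)$ the inclusion into $F(\Omega^iB)$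 followed by the projection; $\underline{F}(\Omega^{i+1}B)\to L_iF(B)$ induced by $F(m_i):F(\Omega^{i+1}B)\to\mathrm{Ker}\,F(\partial_i)$. *)

(* Defs.v *)
From HB Require Import structures.
From mathcomp Require Import all_boot all_algebra.
From mathcomp Require Import boolp.
From mathcomp.multinomials Require Import freeg.

Set Implicit Arguments.
Unset Strict Implicit.
Unset Printing Implicit Defensive.

Import GRing.Theory.
Local Open Scope ring_scope.

Lemma additive_ext (U V : zmodType) (f g : {additive U -> V}) : f =1 g -> f = g.
Proof.
case: f => f [[mf]]; case: g => g [[mg]] /= /funext fg.
by move: mf mg; rewrite fg => mf mg; rewrite (Prop_irrelevance mf mg).
Qed.

Lemma linear_ext (R : pzRingType) (U V : lmodType R) (f g : {linear U -> V}) :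
  f =1 g -> f = g.
Proof.
case: f => f [[mf] [sf]]; case: g => g [[mg] [sg]] /= /funext fg.
move: mf mg sf sg; rewrite fg => mf mg sf sg.
by rewrite (Prop_irrelevance mf mg) (Prop_irrelevance sf sg).
Qed.

Record submodule (R : pzRingType) (V : lmodType R) := Submodule {
  smod : {pred V};
  smod_closed : GRing.submod_closed smod }.

HB.instance Definition _ (R : pzRingType) (V : lmodType R) (S : submodule V) :=
  GRing.isSubmodClosed.Build R V (smod S)
    (GRing.submod_closed_semi (smod_closed S)).

Definition smod_zmod (R : pzRingType) (V : lmodType R) (S : submodule V) :
  zmodClosed V := smod S.
Coercion smod_zmod : submodule >-> zmodClosed.

Definition subz (V : zmodType) (S : zmodClosed V) := {x : V | x \in S}.
Definition quotz (V : zmodType) (S : zmodClosed V) := Quotient.quot S.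

Section SubZ.
Variables (V : zmodType) (S : zmodClosed V).
HB.instance Definition _ := [isSub for (@sval V _ : subz S -> V)].
HB.instance Definition _ := [Choice of subz S by <:].
HB.instance Definition _ := [SubChoice_isSubZmodule of subz S by <:].
HB.instance Definition _ := GRing.Zmodule.on (quotz S).

Definition incl : {additive subz S -> V} := (val : subz S -> V).
Definition proj : {additive V -> quotz S} := \pi_(Quotient.quot S)%qT.

Lemma incl_inj : injective incl. Proof. exact: val_inj. Qed.

Lemma inclP x : incl x \in S. Proof. exact: valP. Qed.

Lemma subz_ex v : v \in S -> exists x, incl x = v.
Proof. by move=> vS; exists (Sub v vS); exact: SubK. Qed.

Definition lift_of (x : quotz S) : V := repr x.
Lemma lift_ofK x : proj (lift_of x) = x. Proof. exact: reprK. Qed.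

Lemma proj_surj x : exists v, proj v = x.
Proof. by exists (lift_of x); exact: lift_ofK. Qed.

Lemma proj_eq0 v : (proj v == 0) = (v \in S).
Proof.
rewrite -[v in RHS]subr0 Quotient.idealrBE.
by rewrite (raddf0 (\pi_(Quotient.quot S)%qT)).
Qed.
End SubZ.
Arguments incl {V} S.
Arguments proj {V} S.

HB.instance Definition _ (R : pzRingType) (V : lmodType R) (S : submodule V) :=
  GRing.SubZmodule_isSubLmodule.Build R V (fun x => x \in smod_zmod S) (subz S)
    (GRing.submod_closed_semi (smod_closed S)).

Section QuotLmod.
Variables (R : pzRingType) (V : lmodType R) (S : submodule V).

Definition quot_scale (a : R) (x : quotz S) : quotz S :=
  proj S (a *: lift_of x).

Lemma quot_scaleE a v : quot_scale a (proj S v) = proj S (a *: v).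
Proof.
rewrite /quot_scale; move: (lift_of _) (lift_ofK (proj S v)) => w.
move/esym/eqP; rewrite -subr_eq0 -raddfB proj_eq0 => wv.
apply/eqP; rewrite -subr_eq0 -raddfB proj_eq0 -scalerBr -opprB scalerN.
by rewrite rpredN; apply: (GRing.rpredZ (s := smod S)).
Qed.

Fact quot_scaleA a b v : quot_scale a (quot_scale b v) = quot_scale (a * b) v.
Proof.
have [w <-] := proj_surj v.
by rewrite [quot_scale b _]quot_scaleE !quot_scaleE scalerA.
Qed.

Fact quot_scale1 : left_id 1 quot_scale.
Proof. by move=> v; have [w <-] := proj_surj v; rewrite quot_scaleE scale1r. Qed.

Fact quot_scaleDr : right_distributive quot_scale +%R.
Proof.
move=> a u v; have [w <-] := proj_surj v; have [x <-] := proj_surj u.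
by rewrite -raddfD !quot_scaleE scalerDr raddfD.
Qed.

Fact quot_scaleDl v : {morph quot_scale^~ v : a b / a + b}.
Proof.
by move=> a b; have [w <-] := proj_surj v; rewrite !quot_scaleE scalerDl raddfD.
Qed.

HB.instance Definition _ := GRing.Zmodule_isLmodule.Build R (quotz S)
  quot_scaleA quot_scale1 quot_scaleDr quot_scaleDl.
End QuotLmod.

Section Maps.
Variables (V W : zmodType) (f : {additive V -> W}).

Definition kerp : {pred V} := [pred x | f x == 0].
Definition imp : {pred W} := [pred y | `[< exists x, f x = y >]].

Lemma kerpP x : reflect (f x = 0) (x \in kerp). Proof. exact: eqP. Qed.
Lemma impP y : reflect (exists x, f x = y) (y \in imp). Proof. exact: asboolP. Qed.

Fact kerp_closed : zmod_closed kerp.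
Proof.
split=> [|x y /kerpP fx /kerpP fy]; apply/kerpP; first exact: raddf0.
by rewrite raddfB fx fy subr0.
Qed.

Fact imp_closed : zmod_closed imp.
Proof.
split=> [|_ _ /impP[x <-] /impP[y <-]]; apply/impP; first by exists 0; exact: raddf0.
by exists (x - y); rewrite raddfB.
Qed.

HB.instance Definition _ := GRing.isZmodClosed.Build V kerp kerp_closed.
HB.instance Definition _ := GRing.isZmodClosed.Build W imp imp_closed.

Definition kerz : zmodClosed V := kerp.
Definition imz : zmodClosed W := imp.
End Maps.

Definition fullp (V : zmodType) : {pred V} := predT.
Fact fullp_closed (V : zmodType) : zmod_closed (@fullp V). Proof. by []. Qed.
HB.instance Definition _ (V : zmodType) :=
  GRing.isZmodClosed.Build V (@fullp V) (@fullp_closed V).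
Definition fullz (V : zmodType) : zmodClosed V := @fullp V.

Section LinearMaps.
Variables (R : pzRingType) (V W : lmodType R) (f : {linear V -> W}).

Fact kerp_submod : GRing.submod_closed (kerp f).
Proof.
split=> [|a x y /kerpP fx /kerpP fy]; apply/kerpP; first exact: raddf0.
by apply: (etrans (linearP f a x y)); move: fx fy => /= -> ->; rewrite scaler0 addr0.
Qed.

Fact imp_submod : GRing.submod_closed (imp f).
Proof.
split=> [|a _ _ /impP[x <-] /impP[y <-]]; apply/impP.
  by exists 0; exact: raddf0.
by exists (a *: x + y); exact: (linearP f).
Qed.

Definition kerm : submodule V := Submodule kerp_submod.
Definition imm : submodule W := Submodule imp_submod.
End LinearMaps.

Section InducedMaps.
Variables (V W : zmodType) (f : {additive V -> W}).

Section Quot.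
Variables (S : zmodClosed V) (f0 : forall x, x \in S -> f x = 0).

Definition quot_lift_fun (x : quotz S) : W := f (lift_of x).

Lemma quot_lift_funE v : quot_lift_fun (proj S v) = f v.
Proof.
rewrite /quot_lift_fun; move: (lift_of _) (lift_ofK (proj S v)) => w.
move/eqP; rewrite -subr_eq0 -raddfB proj_eq0 => /f0/eqP.
by rewrite raddfB subr_eq0 => /eqP.
Qed.

Fact quot_lift_additive : zmod_morphism quot_lift_fun.
Proof.
move=> u v; have [w <-] := proj_surj v; have [x <-] := proj_surj u.
by rewrite -raddfB !quot_lift_funE raddfB.
Qed.

Fact quot_lift_ex :
  exists g : {additive quotz S -> W}, forall v, g (proj S v) = f v.
Proof.
pose gM := GRing.isZmodMorphism.Build _ _ quot_lift_fun quot_lift_additive.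
pose g : {additive quotz S -> W} := HB.pack quot_lift_fun gM.
exists g.
exact: quot_lift_funE.
Qed.
Definition quot_lift : {additive quotz S -> W} := sval (cid quot_lift_ex).

Lemma quot_liftE v : quot_lift (proj S v) = f v.
Proof. exact: (svalP (cid quot_lift_ex)). Qed.
End Quot.

Section Sub.
Variables (S : zmodClosed V) (T : zmodClosed W).
Hypothesis fST : forall x, x \in S -> f x \in T.

Definition sub_map_fun (x : subz S) : subz T := Sub (f (val x)) (fST (valP x)).
Fact sub_map_additive : zmod_morphism sub_map_fun.
Proof. by move=> x y; apply: val_inj; rewrite /= !raddfB. Qed.
HB.instance Definition _ :=
  GRing.isZmodMorphism.Build (subz S) (subz T) sub_map_fun sub_map_additive.
Definition sub_map : {additive subz S -> subz T} := sub_map_fun.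

Lemma sub_mapE x : incl T (sub_map x) = f (incl S x).
Proof. exact: SubK. Qed.
End Sub.

Section Corestrict.
Variables (T : zmodClosed W) (fT : forall x, f x \in T).

Definition corestrict_fun (x : V) : subz T := Sub (f x) (fT x).
Fact corestrict_additive : zmod_morphism corestrict_fun.
Proof. by move=> x y; apply: val_inj; rewrite /= raddfB. Qed.
HB.instance Definition _ :=
  GRing.isZmodMorphism.Build V (subz T) corestrict_fun corestrict_additive.
Definition corestrict : {additive V -> subz T} := corestrict_fun.

Lemma corestrictE x : incl T (corestrict x) = f x.
Proof. exact: SubK. Qed.
End Corestrict.
End InducedMaps.

Section QuotMap.
Variables (V W : zmodType) (f : {additive V -> W}).
Variables (S : zmodClosed V) (T : zmodClosed W).
Hypothesis fST : forall x, x \in S -> f x \in T.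

Fact quot_map_subproof x : x \in S -> (proj T \o f) x = 0.
Proof. by move/fST; rewrite -proj_eq0 => /eqP. Qed.

Definition quot_map : {additive quotz S -> quotz T} :=
  quot_lift quot_map_subproof.

Lemma quot_mapE v : quot_map (proj S v) = proj T (f v).
Proof. exact: quot_liftE. Qed.
End QuotMap.

(* [subquot Z B] is Z / (Z ∩ B), i.e. the subquotient Z / B when B ⊆ Z. *)
Section SubQuot.
Variables (V : zmodType) (Z B : zmodClosed V).

Definition restrp : {pred subz Z} := [pred x | incl Z x \in B].
Fact restrp_closed : zmod_closed restrp.
Proof.
by split=> [|x y xB yB]; rewrite !inE ?raddf0 ?rpred0 // raddfB rpredB.
Qed.
HB.instance Definition _ := GRing.isZmodClosed.Build (subz Z) restrp restrp_closed.
Definition restr : zmodClosed (subz Z) := restrp.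

Lemma restrE x : (x \in restr) = (incl Z x \in B). Proof. by []. Qed.

Definition subquot : zmodType := quotz restr.
Definition cls : {additive subz Z -> subquot} := proj restr.
End SubQuot.
Arguments restrp {V} Z B.
Arguments restr {V} Z B.
Arguments cls {V} Z B.

Section SubQuotMap.
Variables (V W : zmodType) (f : {additive V -> W}).
Variables (Z B : zmodClosed V) (Z' B' : zmodClosed W).
Hypothesis fZ : forall x, x \in Z -> f x \in Z'.
Hypothesis fB : forall x, x \in B -> f x \in B'.

Fact subquot_map_subproof x :
  x \in restr Z B -> sub_map fZ x \in restr Z' B'.
Proof. by rewrite !restrE sub_mapE; apply: fB. Qed.

Definition subquot_map : {additive subquot Z B -> subquot Z' B'} :=
  quot_map subquot_map_subproof.

Lemma subquot_mapE x : subquot_map (cls Z B x) = cls Z' B' (sub_map fZ x).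
Proof. exact: quot_mapE. Qed.
End SubQuotMap.

Lemma cls_surj (V : zmodType) (Z B : zmodClosed V) (x : subquot Z B) :
  exists z, cls Z B z = x.
Proof. exact: proj_surj. Qed.

Lemma cls_eq (V : zmodType) (Z B : zmodClosed V) (x y : subz Z) :
  incl Z x - incl Z y \in B -> cls Z B x = cls Z B y.
Proof.
move=> xy; apply/eqP; rewrite -subr_eq0 -raddfB.
by rewrite proj_eq0 restrE raddfB.
Qed.

Section SubQuotMapTheory.
Variables (V W X : zmodType) (Z B : zmodClosed V) (Z' B' : zmodClosed W).
Variables (Z'' B'' : zmodClosed X).

Lemma subquot_map_id (f : {additive V -> V}) fZ fB :
  (forall v, f v = v) -> forall x, @subquot_map V V f Z B Z B fZ fB x = x.
Proof.
move=> f1 x; have [z <-] := cls_surj x; rewrite subquot_mapE; apply: cls_eq.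
by rewrite sub_mapE f1 subrr rpred0.
Qed.

Lemma subquot_map_comp (h : {additive V -> X}) (g : {additive W -> X})
    (f : {additive V -> W}) hZ hB gZ gB fZ fB :
  (forall v, h v = g (f v)) -> forall x,
  @subquot_map V X h Z B Z'' B'' hZ hB x =
  @subquot_map W X g Z' B' Z'' B'' gZ gB (@subquot_map V W f Z B Z' B' fZ fB x).
Proof.
move=> hgf x; have [z <-] := cls_surj x; rewrite !subquot_mapE; apply: cls_eq.
by rewrite !sub_mapE hgf subrr rpred0.
Qed.

Lemma subquot_map_add (h f g : {additive V -> W}) hZ hB fZ fB gZ gB :
  (forall v, h v = f v + g v) -> forall x,
  @subquot_map V W h Z B Z' B' hZ hB x =
  @subquot_map V W f Z B Z' B' fZ fB x + @subquot_map V W g Z B Z' B' gZ gB x.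
Proof.
move=> hfg x; have [z <-] := cls_surj x; rewrite !subquot_mapE -raddfD.
by apply: cls_eq; rewrite (raddfD (incl Z')) !sub_mapE hfg subrr rpred0.
Qed.

Lemma subquot_map_eq (f g : {additive V -> W}) fZ fB gZ gB :
  (forall v, v \in Z -> f v - g v \in B') -> forall x,
  @subquot_map V W f Z B Z' B' fZ fB x = @subquot_map V W g Z B Z' B' gZ gB x.
Proof.
move=> fg x; have [z <-] := cls_surj x; rewrite !subquot_mapE; apply: cls_eq.
by rewrite !sub_mapE fg // inclP.
Qed.
End SubQuotMapTheory.

Section SubQuotLmod.
Variables (R : pzRingType) (V : lmodType R) (Z B : submodule V).
Fact restrp_submod : GRing.submod_closed (restrp Z B).
Proof.
split=> [|a x y xB yB]; rewrite !inE ?raddf0 ?rpred0 //.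
by have [_] := smod_closed B; apply.
Qed.
Definition subquotm : lmodType R := quotz (Submodule restrp_submod).
End SubQuotLmod.

Record addFunctor (R : pzRingType) := AddFunctor {
  fobj :> lmodType R -> zmodType;
  fmap : forall M N : lmodType R, {linear M -> N} -> {additive fobj M -> fobj N};
  fmap_id : forall (M : lmodType R) x, fmap (idfun : {linear M -> M}) x = x;
  fmap_comp : forall (M N P : lmodType R) (g : {linear N -> P}) (f : {linear M -> N}) x,
    fmap (g \o f : {linear M -> P}) x = fmap g (fmap f x);
  fmap_add : forall (M N : lmodType R) (f g : {linear M -> N}) x,
    fmap (f \+ g : {linear M -> N}) x = fmap f x + fmap g x }.
Arguments fmap {R} F {M N} f : rename.

Record natTrans (R : pzRingType) (F G : addFunctor R) := NatTrans {
  nat_map :> forall M : lmodType R, {additive F M -> G M};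
  nat_comm : forall (M N : lmodType R) (f : {linear M -> N}) x,
    nat_map N (fmap F f x) = fmap G f (nat_map M x) }.

Definition naturally_isomorphic (R : pzRingType) (F G : addFunctor R) :=
  exists t : natTrans F G, forall M, bijective (t M).

Definition exact_at (A B C : zmodType) (f : {additive A -> B}) (g : {additive B -> C}) :=
  forall y, g y = 0 <-> exists x, f x = y.

(* A right R-module is a left module over the converse ring [R^c]: the right  *)
(* action a r is [(r : R^c) *: a].                                            *)

Section Tensor.
Variables (R : pzRingType) (A : lmodType R^c) (M : lmodType R).

Definition tfree : zmodType := {freeg (A * M)%type / int}.
Definition tgen (a : A) (m : M) : tfree := << (a, m) >>.

Inductive tensor_relator : tfree -> Prop :=
| TensorDl a a' m : tensor_relator (tgen (a + a') m - (tgen a m + tgen a' m))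
| TensorDr a m m' : tensor_relator (tgen a (m + m') - (tgen a m + tgen a m'))
| TensorZ a (r : R) m :
    tensor_relator (tgen ((r : R^c) *: a) m - tgen a (r *: m)).

Definition tensor_relp : {pred tfree} := [pred x | `[< forall S : zmodClosed tfree,
  (forall y, tensor_relator y -> y \in S) -> x \in S >]].

Fact tensor_relp_closed : zmod_closed tensor_relp.
Proof.
split=> [|x y /asboolP xS /asboolP yS]; apply/asboolP => S SR; first exact: rpred0.
by rewrite rpredB ?xS ?yS.
Qed.
HB.instance Definition _ := GRing.isZmodClosed.Build tfree tensor_relp tensor_relp_closed.
Definition tensor_rel : zmodClosed tfree := tensor_relp.

Definition tensor : zmodType := quotz tensor_rel.
Definition tens (a : A) (m : M) : tensor := proj tensor_rel (tgen a m).

Lemma tensor_relator0 y : tensor_relator y -> proj tensor_rel y = 0.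
Proof. by move=> yR; apply/eqP; rewrite proj_eq0; apply/asboolP => S; apply. Qed.

Lemma tensDl a a' m : tens (a + a') m = tens a m + tens a' m.
Proof.
apply/eqP; rewrite -subr_eq0 -raddfD -raddfB; apply/eqP/tensor_relator0.
exact: TensorDl.
Qed.

Lemma tensDr a m m' : tens a (m + m') = tens a m + tens a m'.
Proof.
apply/eqP; rewrite -subr_eq0 -raddfD -raddfB; apply/eqP/tensor_relator0.
exact: TensorDr.
Qed.

Lemma tensZ a (r : R) m : tens ((r : R^c) *: a) m = tens a (r *: m).
Proof.
apply/eqP; rewrite -subr_eq0 -raddfB; apply/eqP/tensor_relator0.
exact: TensorZ.
Qed.

Lemma tfree_ext (G : zmodType) (f g : {additive tfree -> G}) :
  (forall a m, f (tgen a m) = g (tgen a m)) -> f =1 g.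
Proof.
move=> fg x; rewrite -(freeg_sumE x) !raddf_sum; apply: eq_bigr => -[a m] _.
have -> : << coeff (a, m) x *g (a, m) >> = tgen a m *~ coeff (a, m) x.
  by rewrite /tgen freeg_mulz intz.
by rewrite !raddfMz fg.
Qed.

Lemma tensor_ext (G : zmodType) (f g : {additive tensor -> G}) :
  (forall a m, f (tens a m) = g (tens a m)) -> f =1 g.
Proof.
move=> fg x; have [y <-] := proj_surj x.
exact: (@tfree_ext G (f \o proj tensor_rel) (g \o proj tensor_rel)).
Qed.

Section Universal.
Variables (G : zmodType) (b : A -> M -> G).
Hypothesis bDl : forall a a' m, b (a + a') m = b a m + b a' m.
Hypothesis bDr : forall a m m', b a (m + m') = b a m + b a m'.
Hypothesis bZ : forall a (r : R) m, b ((r : R^c) *: a) m = b a (r *: m).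

Definition tfree_lift_fun (x : tfree) : G :=
  fglift (fun am : A * M => b am.1 am.2 : zmodule G) x.
Fact tfree_lift_additive : zmod_morphism tfree_lift_fun.
Proof.
move=> x y.
exact: (lift_is_additive (fun am : A * M => b am.1 am.2 : zmodule G) x y).
Qed.
HB.instance Definition _ :=
  GRing.isZmodMorphism.Build tfree G tfree_lift_fun tfree_lift_additive.
Definition tfree_lift : {additive tfree -> G} := tfree_lift_fun.

Lemma tfree_liftE a m : tfree_lift (tgen a m) = b a m.
Proof. by rewrite /= /tfree_lift_fun /tgen liftU scale1r. Qed.

Fact tensor_lift_subproof x : x \in tensor_rel -> tfree_lift x = 0.
Proof.
move=> /asboolP/(_ (kerz tfree_lift)) xR; apply/kerpP/xR => _ [a a' m|a m m'|a r m];
  apply/kerpP; rewrite raddfB ?(raddfD tfree_lift) !tfree_liftE.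
- by rewrite bDl subrr.
- by rewrite bDr subrr.
- by rewrite bZ subrr.
Qed.

Definition tensor_lift : {additive tensor -> G} := quot_lift tensor_lift_subproof.

Lemma tensor_liftE a m : tensor_lift (tens a m) = b a m.
Proof. by rewrite [LHS]quot_liftE tfree_liftE. Qed.
End Universal.
End Tensor.

Section TensorMap.
Variables (R : pzRingType) (A A' : lmodType R^c) (M M' : lmodType R).
Variables (f : {linear A -> A'}) (g : {linear M -> M'}).

Let b a m := tens (f a) (g m).
Fact tensor_map_subDl a a' m : b (a + a') m = b a m + b a' m.
Proof. by rewrite /b raddfD tensDl. Qed.
Fact tensor_map_subDr a m m' : b a (m + m') = b a m + b a m'.
Proof. by rewrite /b raddfD tensDr. Qed.
Fact tensor_map_subZ a (r : R) m : b ((r : R^c) *: a) m = b a (r *: m).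
Proof. by rewrite /b !linearZ tensZ. Qed.

Definition tensor_map : {additive tensor A M -> tensor A' M'} :=
  tensor_lift tensor_map_subDl tensor_map_subDr tensor_map_subZ.

Lemma tensor_mapE a m : tensor_map (tens a m) = tens (f a) (g m).
Proof. exact: tensor_liftE. Qed.
End TensorMap.

Section TensorMapTheory.
Variable R : pzRingType.
Implicit Types (A : lmodType R^c) (M : lmodType R).

Lemma tensor_map_comp A A' A'' M M' M'' (f' : {linear A' -> A''}) (f : {linear A -> A'})
    (g' : {linear M' -> M''}) (g : {linear M -> M'}) x :
  tensor_map (f' \o f) (g' \o g) x = tensor_map f' g' (tensor_map f g x).
Proof.
move: x; apply: (tensor_ext (g := tensor_map f' g' \o tensor_map f g)) => a m.
by rewrite /= !tensor_mapE.
Qed.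

Lemma tensor_map_compr A M M' M'' (g' : {linear M' -> M''}) (g : {linear M -> M'}) x :
  tensor_map (@idfun A) (g' \o g) x = tensor_map idfun g' (tensor_map idfun g x).
Proof. by rewrite -tensor_map_comp; congr (tensor_map _ _ x); exact: linear_ext. Qed.

Lemma tensor_map_id A M x : tensor_map (@idfun A) (@idfun M) x = x.
Proof.
by move: x; apply: (tensor_ext (g := idfun)) => a m; rewrite tensor_mapE.
Qed.

Lemma tensor_map_addr A A' M M' (f : {linear A -> A'}) (g h : {linear M -> M'}) x :
  tensor_map f (g \+ h) x = tensor_map f g x + tensor_map f h x.
Proof.
move: x; apply: (tensor_ext (g := tensor_map f g \+ tensor_map f h)) => a m.
by rewrite /= !tensor_mapE tensDr.
Qed.

Lemma tensor_map_xchg A A' M M' (f : {linear A -> A'}) (g : {linear M -> M'}) x :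
  tensor_map f idfun (tensor_map idfun g x) = tensor_map idfun g (tensor_map f idfun x).
Proof.
move: x; apply: (tensor_ext (f := tensor_map f idfun \o tensor_map idfun g)
  (g := tensor_map idfun g \o tensor_map f idfun)) => a m.
by rewrite /= !tensor_mapE.
Qed.
End TensorMapTheory.

Definition tensor_functor (R : pzRingType) (A : lmodType R^c) : addFunctor R :=
  @AddFunctor R (tensor A) (fun M N f => tensor_map idfun f)
    (fun M x => tensor_map_id x)
    (fun M N P g f x => tensor_map_compr g f x)
    (fun M N f g x => tensor_map_addr idfun f g x).

Definition flat (R : pzRingType) (A : lmodType R^c) :=
  forall (M N : lmodType R) (f : {linear M -> N}),
    injective f -> injective (fmap (tensor_functor A) f).

(* Only the components [diff (k + 1) k] carry information, the others vanish; *)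
(* this avoids transporting along [k + 1 - 1 = k].                            *)
Record chain_complex (S : pzRingType) := ChainComplex {
  chain :> int -> lmodType S;
  diff : forall i j : int, {linear chain i -> chain j};
  diff_shape : forall i j, i != j + 1 -> forall x, diff i j x = 0;
  diff_comp : forall i j k x, diff j k (diff i j x) = 0 }.

Section ComplexHomology.
Variables (S : pzRingType) (C : chain_complex S) (n : int).

Definition cycles : submodule (C n) := kerm (diff C n (n - 1)).
Definition boundaries : submodule (C n) := imm (diff C (n + 1) n).
Definition homology : lmodType S := subquotm cycles boundaries.
Definition chain_mod_boundaries : lmodType S := quotz boundaries.
End ComplexHomology.

Section TensorHomology.
Variables (R : pzRingType) (C : chain_complex R^c) (n : int).
Implicit Types M N P : lmodType R.

Definition tensor_diff M i j : {additive tensor (C i) M -> tensor (C j) M} :=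
  tensor_map (diff C i j) idfun.

Definition tensor_cycles M := kerz (tensor_diff M n (n - 1)).
Definition tensor_boundaries M := imz (tensor_diff M (n + 1) n).
Definition tensor_homology M := subquot (tensor_cycles M) (tensor_boundaries M).

Section Map.
Variables (M N : lmodType R) (f : {linear M -> N}).
Let g : {additive tensor (C n) M -> tensor (C n) N} := tensor_map idfun f.

Fact tensor_homology_cycles x : x \in tensor_cycles M -> g x \in tensor_cycles N.
Proof.
move=> /kerpP x0; apply/kerpP; rewrite [LHS]tensor_map_xchg.
by apply: etrans (raddf0 (tensor_map idfun f)); congr (tensor_map _ _ _).
Qed.

Fact tensor_homology_boundaries x :
  x \in tensor_boundaries M -> g x \in tensor_boundaries N.
Proof.
move=> /impP[y <-]; apply/impP; exists (tensor_map idfun f y).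
exact: tensor_map_xchg.
Qed.

Definition tensor_homology_map : {additive tensor_homology M -> tensor_homology N} :=
  subquot_map tensor_homology_cycles tensor_homology_boundaries.
End Map.
End TensorHomology.

Definition tensor_homology_functor (R : pzRingType) (C : chain_complex R^c) (n : int) :
    addFunctor R :=
  @AddFunctor R (tensor_homology C n) (@tensor_homology_map R C n)
    (fun M => subquot_map_id _ _ (@tensor_map_id R (C n) M))
    (fun M N P g f => subquot_map_comp _ _ _ _ _ _ (@tensor_map_compr R (C n) M N P g f))
    (fun M N f g => subquot_map_add _ _ _ _ _ _ (@tensor_map_addr R (C n) (C n) M N idfun f g)).

Definition projective (R : pzRingType) (P : lmodType R) :=
  forall (M N : lmodType R) (p : {linear M -> N}) (f : {linear P -> N}),
    (forall y, exists x, p x = y) ->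
    exists g : {linear P -> M}, forall x, p (g x) = f x.

(* [O i] is the (i+1)-st syzygy, so that [syzygy B O i] is the i-th one. *)
Definition syzygy (R : pzRingType) (B : lmodType R) (O : nat -> lmodType R) (i : nat) :=
  if i is j.+1 then O j else B.

(* A projective resolution of B, spliced from the short exact sequences       *)
(*   0 -> Om (i+1) --m i--> P i --e i--> Om i -> 0                            *)
(* with Om 0 = B: any kernels of the e i are allowed, and the differential    *)
(* [pdiff] is recovered as m i \o e (i+1).                                    *)
Record resolution (R : pzRingType) (B : lmodType R) := Resolution {
  proj_of : nat -> lmodType R;
  syz_of : nat -> lmodType R;
  res_e : forall i, {linear proj_of i -> syzygy B syz_of i};
  res_m : forall i, {linear syzygy B syz_of i.+1 -> proj_of i};
  proj_of_projective : forall i, projective (proj_of i);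
  res_e_surj : forall i y, exists x, res_e i x = y;
  res_m_inj : forall i, injective (res_m i);
  res_exact : forall i, exact_at (res_m i) (res_e i) }.
Arguments res_exact {R B} r i y.
Arguments res_e_surj {R B} r i y.
Arguments res_m_inj {R B} r i [x1 x2].
Arguments proj_of_projective {R B} r i.

Definition Om (R : pzRingType) (B : lmodType R) (P : resolution B) (i : nat) :=
  syzygy B (syz_of P) i.

Definition pdiff (R : pzRingType) (B : lmodType R) (P : resolution B) (i : nat) :
  {linear proj_of P i.+1 -> proj_of P i} := res_m P i \o res_e P i.+1.

Section Lifts.
Variable R : pzRingType.
Implicit Types B : lmodType R.

Record lifting (B B' : lmodType R) (f : {linear B -> B'})
    (P : resolution B) (P' : resolution B') := Lifting {
  lift_P : forall i, {linear proj_of P i -> proj_of P' i};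
  lift_Om : forall i, {linear Om P i -> Om P' i};
  lift_0 : lift_Om 0 = f;
  lift_e : forall i x, res_e P' i (lift_P i x) = lift_Om i (res_e P i x);
  lift_m : forall i x, res_m P' i (lift_Om i.+1 x) = lift_P i (res_m P i x) }.

Arguments lift_e {B B' f P P'} l i x.
Arguments lift_m {B B' f P P'} l i x.

Lemma res_em B (P : resolution B) i x : res_e P i (res_m P i x) = 0.
Proof. by apply: (proj2 (res_exact P i _)); exists x. Qed.

Lemma res_m_factor B (P : resolution B) i (X : lmodType R)
    (h : {linear X -> proj_of P i}) :
  (forall x, res_e P i (h x) = 0) ->
  exists k : {linear X -> Om P i.+1}, forall x, res_m P i (k x) = h x.
Proof.
move=> h0; have kx x : exists y, res_m P i y = h x
  by apply: (proj1 (res_exact P i _)); exact: h0.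
pose k x : Om P i.+1 := sval (cid (kx x)).
have kE x : res_m P i (k x) = h x by exact: (svalP (cid (kx x))).
have kl : linear k.
  by move=> a x y; apply: (res_m_inj P i); rewrite linearP !kE linearP.
pose kM := GRing.isLinear.Build _ _ _ _ k kl.
by pose k' : {linear X -> Om P i.+1} := HB.pack k kM; exists k'.
Qed.

Lemma lifting_step B B' (P : resolution B) (P' : resolution B') i
    (g : {linear Om P i -> Om P' i}) :
  exists pk : {linear proj_of P i -> proj_of P' i} * {linear Om P i.+1 -> Om P' i.+1},
    (forall x, res_e P' i (pk.1 x) = g (res_e P i x)) /\
    (forall x, res_m P' i (pk.2 x) = pk.1 (res_m P i x)).
Proof.
have [p pE] := proj_of_projective P i _ _ _ (g \o res_e P i) (res_e_surj P' i).
have [x|k kE] := res_m_factor (P := P') (h := p \o res_m P i).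
  by rewrite [LHS]pE /= res_em raddf0.
by exists (p, k).
Qed.

Fixpoint lifting_Om B B' (f : {linear B -> B'}) (P : resolution B) (P' : resolution B') i :
    {linear Om P i -> Om P' i} :=
  if i is j.+1 then (sval (cid (lifting_step (lifting_Om f P P' j)))).2 else f.

Definition chosen_lifting B B' (f : {linear B -> B'}) (P : resolution B) (P' : resolution B') :
    lifting f P P' :=
  let step i := cid (lifting_step (lifting_Om f P P' i)) in
  @Lifting B B' f P P' (fun i => (sval (step i)).1) (lifting_Om f P P')
    erefl (fun i => (svalP (step i)).1) (fun i => (svalP (step i)).2).

Definition lifting_id B (P : resolution B) : lifting idfun P P :=
  @Lifting B B idfun P P (fun i => idfun) (fun i => idfun) erefl
    (fun i x => erefl) (fun i x => erefl).

Section Comp.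
Variables (B B' B'' : lmodType R) (g : {linear B' -> B''}) (f : {linear B -> B'}).
Variables (P : resolution B) (P' : resolution B') (P'' : resolution B'').
Variables (lg : lifting g P' P'') (lf : lifting f P P').

Fact lifting_comp0 : lift_Om lg 0 \o lift_Om lf 0 = g \o f :> {linear _ -> _}.
Proof. by apply: linear_ext => x /=; rewrite !lift_0. Qed.

Fact lifting_compe i x : res_e P'' i ((lift_P lg i \o lift_P lf i) x) =
  (lift_Om lg i \o lift_Om lf i) (res_e P i x).
Proof. by rewrite /= !lift_e. Qed.

Fact lifting_compm i x : res_m P'' i ((lift_Om lg i.+1 \o lift_Om lf i.+1) x) =
  (lift_P lg i \o lift_P lf i) (res_m P i x).
Proof. by rewrite /= !lift_m. Qed.

Definition lifting_comp : lifting (g \o f) P P'' :=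
  Lifting lifting_comp0 lifting_compe lifting_compm.
End Comp.

Section Add.
Variables (B B' : lmodType R) (f g : {linear B -> B'}).
Variables (P : resolution B) (P' : resolution B').
Variables (lf : lifting f P P') (lg : lifting g P P').

Fact lifting_add0 : lift_Om lf 0 \+ lift_Om lg 0 = f \+ g :> {linear _ -> _}.
Proof. by apply: linear_ext => x /=; rewrite !lift_0. Qed.

Fact lifting_adde i x : res_e P' i ((lift_P lf i \+ lift_P lg i) x) =
  (lift_Om lf i \+ lift_Om lg i) (res_e P i x).
Proof. by apply: etrans (raddfD (res_e P' i) _ _) _; congr (_ + _); exact: lift_e. Qed.

Fact lifting_addm i x : res_m P' i ((lift_Om lf i.+1 \+ lift_Om lg i.+1) x) =
  (lift_P lf i \+ lift_P lg i) (res_m P i x).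
Proof. by apply: etrans (raddfD (res_m P' i) _ _) _; congr (_ + _); exact: lift_m. Qed.

Definition lifting_add : lifting (f \+ g) P P' :=
  Lifting lifting_add0 lifting_adde lifting_addm.
End Add.

Lemma lifting_homotopy B B' (f : {linear B -> B'}) (P : resolution B)
    (P' : resolution B') (l l' : lifting f P P') i :
  exists (u : {linear Om P i -> proj_of P' i})
         (s : {linear proj_of P i -> proj_of P' i.+1}),
  [/\ forall x, lift_Om l i x = lift_Om l' i x + res_e P' i (u x),
      forall x, lift_P l i x =
                lift_P l' i x + (u (res_e P i x) + pdiff P' i (s x)) &
      match i return {linear Om P i -> proj_of P' i} -> Prop with
      | 0 => fun u => forall x, u x = 0
      | j.+1 => fun u => exists v : {linear proj_of P j -> proj_of P' j.+1},
                         forall x, u x = v (res_m P j x)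
      end u].
Proof.
have step j (u : {linear Om P j -> proj_of P' j}) :
    (forall x, lift_Om l j x = lift_Om l' j x + res_e P' j (u x)) ->
    exists s : {linear proj_of P j -> proj_of P' j.+1},
      forall x, lift_P l j x =
        lift_P l' j x + (u (res_e P j x) + pdiff P' j (s x)).
  move=> uE; pose h := lift_P l j \- lift_P l' j \- (u \o res_e P j).
  have [x|k kE] := res_m_factor (P := P') (h := h).
    rewrite /h /= !(linearB (res_e P' j)) !lift_e uE.
    by rewrite addrAC addrK subrr.
  have [s sE] := proj_of_projective P j _ _ _ k (res_e_surj P' j.+1).
  exists s => x; rewrite /pdiff /= sE kE /h /=.
  by rewrite [X in _ = _ + X]addrC subrK addrC subrK.
elim: i => [|i [u [s [uE sE _]]]].
  pose u0 : {linear Om P 0 -> proj_of P' 0} := \0.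
  have u0E x : lift_Om l 0 x = lift_Om l' 0 x + res_e P' 0 (u0 x).
    by rewrite !lift_0 /= raddf0 addr0.
  by have [s sE] := step 0 u0 u0E; exists u0, s.
pose v : {linear Om P i.+1 -> proj_of P' i.+1} := s \o res_m P i.
have vE x : lift_Om l i.+1 x = lift_Om l' i.+1 x + res_e P' i.+1 (v x).
  apply: (res_m_inj P' i); rewrite (linearD (res_m P' i)) !lift_m sE res_em.
  by rewrite raddf0 add0r.
have [s' s'E] := step i.+1 v vE.
by exists v, s'; split=> //; exists s.
Qed.
End Lifts.
Arguments lift_e {R B B' f P P'} l i x.
Arguments lift_m {R B B' f P P'} l i x.
Arguments lifting_homotopy {R B B' f P P'} l l' i.

(* A functor on projective resolutions and their morphisms that does not      *)
(* depend on the lift gives, for any choice of resolutions, a functor on      *)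
(* modules.                                                                   *)
Record resFunctor (R : pzRingType) := ResFunctor {
  robj : forall B : lmodType R, resolution B -> zmodType;
  rmap : forall (B B' : lmodType R) (f : {linear B -> B'})
    (P : resolution B) (P' : resolution B'),
    lifting f P P' -> {additive robj P -> robj P'};
  rmap_id : forall (B : lmodType R) (P : resolution B) x,
    rmap (lifting_id P) x = x;
  rmap_comp : forall (B B' B'' : lmodType R) (g : {linear B' -> B''})
    (f : {linear B -> B'}) (P : resolution B) (P' : resolution B')
    (P'' : resolution B'') (lg : lifting g P' P'') (lf : lifting f P P') x,
    rmap (lifting_comp lg lf) x = rmap lg (rmap lf x);
  rmap_add : forall (B B' : lmodType R) (f g : {linear B -> B'})
    (P : resolution B) (P' : resolution B')
    (lf : lifting f P P') (lg : lifting g P P') x,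
    rmap (lifting_add lf lg) x = rmap lf x + rmap lg x;
  rmap_indep : forall (B B' : lmodType R) (f : {linear B -> B'})
    (P : resolution B) (P' : resolution B') (l l' : lifting f P P') x,
    rmap l x = rmap l' x }.
Arguments rmap {R} r {B B' f P P'} _.

Section ResolutionChoice.
Variables (R : pzRingType) (res : forall B : lmodType R, resolution B).

Definition reslift (B B' : lmodType R) (f : {linear B -> B'}) :=
  chosen_lifting f (res B) (res B').

Section Descend.
Variable G : resFunctor R.

Fact descend_id (B : lmodType R) x : rmap G (reslift (@idfun B)) x = x.
Proof. by rewrite (rmap_indep _ (lifting_id _)) rmap_id. Qed.

Fact descend_comp (M N P : lmodType R) (g : {linear N -> P}) (f : {linear M -> N}) x :
  rmap G (reslift (g \o f)) x = rmap G (reslift g) (rmap G (reslift f) x).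
Proof. by rewrite (rmap_indep _ (lifting_comp (reslift g) (reslift f))) rmap_comp. Qed.

Fact descend_add (M N : lmodType R) (f g : {linear M -> N}) x :
  rmap G (reslift (f \+ g)) x = rmap G (reslift f) x + rmap G (reslift g) x.
Proof. by rewrite (rmap_indep _ (lifting_add (reslift f) (reslift g))) rmap_add. Qed.

Definition descend : addFunctor R :=
  @AddFunctor R (fun B => robj G (res B)) (fun B B' f => rmap G (reslift f))
    descend_id descend_comp descend_add.
End Descend.
End ResolutionChoice.

Section AddFunctorTheory.
Variables (R : pzRingType) (F : addFunctor R).

Lemma fmap_ext (M N : lmodType R) (f g : {linear M -> N}) x :
  (forall y, f y = g y) -> fmap F f x = fmap F g x.
Proof. by move=> /linear_ext ->. Qed.

Lemma fmap0 (M N : lmodType R) (f : {linear M -> N}) x :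
  (forall y, f y = 0) -> fmap F f x = 0.
Proof.
move=> f0; apply: (@addrI _ (fmap F f x)); rewrite -fmap_add addr0.
by apply: fmap_ext => y /=; rewrite f0 addr0.
Qed.

Lemma fmap_comp2 (M N N' P : lmodType R) (g : {linear N -> P}) (f : {linear M -> N})
    (g' : {linear N' -> P}) (f' : {linear M -> N'}) x :
  (forall y, g (f y) = g' (f' y)) ->
  fmap F g (fmap F f x) = fmap F g' (fmap F f' x).
Proof. by move=> gf; rewrite -!fmap_comp; apply: fmap_ext. Qed.
End AddFunctorTheory.

Section FundamentalSequence.
Variables (R : pzRingType) (F : addFunctor R).

Section AtResolution.
Variables (B : lmodType R) (P : resolution B).

Definition Fcycles i : zmodClosed (F (proj_of P i)) :=
  match i return zmodClosed (F (proj_of P i)) with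
  | 0 => fullz _
  | j.+1 => kerz (fmap F (pdiff P j))
  end.
Definition Fboundaries i : zmodClosed (F (proj_of P i)) := imz (fmap F (pdiff P i)).

(* The values at B of L_i F, of the quot-stabilization of F at Om i (the      *)
(* cokernel of F(e i)) and of the i-th left satellite of F.                   *)
Definition Lobj i : zmodType := subquot (Fcycles i) (Fboundaries i).
Definition Qobj i : zmodType := quotz (imz (fmap F (res_e P i))).
Definition Sobj i : zmodType :=
  if i is j.+1 then subz (kerz (fmap F (res_m P j))) else F B.
Definition Sincl i : {additive Sobj i -> F (Om P i)} :=
  match i return {additive Sobj i -> F (Om P i)} with
  | 0 => idfun
  | j.+1 => incl (kerz (fmap F (res_m P j)))
  end.

Lemma fmap_pdiff i x :
  fmap F (pdiff P i) x = fmap F (res_m P i) (fmap F (res_e P i.+1) x).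
Proof. exact: fmap_comp. Qed.

Lemma fmap_em i x : fmap F (res_e P i) (fmap F (res_m P i) x) = 0.
Proof. by rewrite -fmap_comp fmap0 // => y; exact: res_em. Qed.

Fact cycles_to_S_subproof i x :
  x \in Fcycles i.+1 -> fmap F (res_e P i.+1) x \in kerz (fmap F (res_m P i)).
Proof. by move=> /kerpP x0; apply/kerpP; rewrite -fmap_pdiff. Qed.

Definition cycles_to_S i : {additive subz (Fcycles i) -> Sobj i} :=
  match i return {additive subz (Fcycles i) -> Sobj i} with
  | 0 => fmap F (res_e P 0) \o incl _
  | j.+1 => sub_map (@cycles_to_S_subproof j)
  end.

Lemma cycles_to_SE i x :
  Sincl i (cycles_to_S i x) = fmap F (res_e P i) (incl (Fcycles i) x).
Proof. by case: i x => [|i] x //; exact: sub_mapE. Qed.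

Lemma Sincl_inj i : injective (Sincl i).
Proof. by case: i => [|i] // x y; exact: incl_inj. Qed.

Fact L_to_S_subproof i x :
  x \in restr (Fcycles i) (Fboundaries i) -> cycles_to_S i x = 0.
Proof.
rewrite restrE => /impP[y xE]; apply: (@Sincl_inj i).
by rewrite cycles_to_SE -xE fmap_pdiff fmap_em raddf0.
Qed.

Definition L_to_S i : {additive Lobj i -> Sobj i} := quot_lift (@L_to_S_subproof i).

Definition S_to_Q i : {additive Sobj i -> Qobj i} :=
  proj (imz (fmap F (res_e P i))) \o Sincl i.

Fact syz_to_cycles_subproof i x : fmap F (res_m P i) x \in Fcycles i.
Proof. by case: i x => [|i] x //; apply/kerpP; rewrite fmap_pdiff fmap_em raddf0. Qed.

Definition syz_to_cycles i : {additive F (Om P i.+1) -> subz (Fcycles i)} :=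
  corestrict (@syz_to_cycles_subproof i).

Fact Q_to_L_subproof i x :
  x \in imz (fmap F (res_e P i.+1)) ->
  (cls (Fcycles i) (Fboundaries i) \o syz_to_cycles i) x = 0.
Proof.
move=> /impP[y <-]; apply/eqP; rewrite [_ == _]proj_eq0 restrE corestrictE.
by apply/impP; exists y; exact: fmap_pdiff.
Qed.

Definition Q_to_L i : {additive Qobj i.+1 -> Lobj i} := quot_lift (@Q_to_L_subproof i).
End AtResolution.

Section AtLifting.
Variables (B B' : lmodType R) (f : {linear B -> B'}).
Variables (P : resolution B) (P' : resolution B') (l : lifting f P P').

Lemma lift_pdiff i x : pdiff P' i (lift_P l i.+1 x) = lift_P l i (pdiff P i x).
Proof. by rewrite /pdiff /= lift_e lift_m. Qed.

Fact Lmap_cycles i x : x \in Fcycles P i -> fmap F (lift_P l i) x \in Fcycles P' i.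
Proof.
case: i x => [|i] x //= /kerpP x0; apply/kerpP.
by rewrite (fmap_comp2 _ (@lift_pdiff i)) x0 raddf0.
Qed.

Fact Lmap_boundaries i x :
  x \in Fboundaries P i -> fmap F (lift_P l i) x \in Fboundaries P' i.
Proof.
move=> /impP[y <-]; apply/impP; exists (fmap F (lift_P l i.+1) y).
exact: fmap_comp2 _ (@lift_pdiff i).
Qed.

Definition Lmap i : {additive Lobj P i -> Lobj P' i} :=
  subquot_map (@Lmap_cycles i) (@Lmap_boundaries i).

Fact Qmap_subproof i x : x \in imz (fmap F (res_e P i)) ->
  fmap F (lift_Om l i) x \in imz (fmap F (res_e P' i)).
Proof.
move=> /impP[y <-]; apply/impP; exists (fmap F (lift_P l i) y).
exact: fmap_comp2 _ (lift_e l i).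
Qed.

Definition Qmap i : {additive Qobj P i -> Qobj P' i} := quot_map (@Qmap_subproof i).

Fact Smap_subproof i x : x \in kerz (fmap F (res_m P i)) ->
  fmap F (lift_Om l i.+1) x \in kerz (fmap F (res_m P' i)).
Proof.
move=> /kerpP x0; apply/kerpP.
by rewrite (fmap_comp2 _ (lift_m l i)) x0 raddf0.
Qed.

Definition Smap i : {additive Sobj P i -> Sobj P' i} :=
  match i return {additive Sobj P i -> Sobj P' i} with
  | 0 => fmap F f
  | j.+1 => sub_map (@Smap_subproof j)
  end.

Lemma SmapE i x : Sincl P' i (Smap i x) = fmap F (lift_Om l i) (Sincl P i x).
Proof.
by case: i x => [|i] x; [rewrite /= lift_0 | exact: sub_mapE].
Qed.

Lemma Lmap_cls i x y : incl (Fcycles P' i) y = fmap F (lift_P l i) (incl (Fcycles P i) x) ->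
  Lmap i (cls _ _ x) = cls _ _ y.
Proof.
by move=> yx; rewrite [LHS]subquot_mapE; apply: cls_eq; rewrite sub_mapE yx subrr rpred0.
Qed.

Lemma L_to_S_natural i x : L_to_S P' i (Lmap i x) = Smap i (L_to_S P i x).
Proof.
have [z <-] := cls_surj x; rewrite [Lmap i _]subquot_mapE.
rewrite [LHS]quot_liftE [L_to_S P i _]quot_liftE.
apply: (@Sincl_inj _ P'); rewrite SmapE !cycles_to_SE sub_mapE.
exact: fmap_comp2 _ (lift_e l i).
Qed.

Lemma S_to_Q_natural i x : S_to_Q P' i (Smap i x) = Qmap i (S_to_Q P i x).
Proof. by rewrite [RHS]quot_mapE [LHS]/= SmapE. Qed.

Lemma Q_to_L_natural i x : Q_to_L P' i (Qmap i.+1 x) = Lmap i (Q_to_L P i x).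
Proof.
have [z <-] := proj_surj x; rewrite [Qmap _ _]quot_mapE.
rewrite [LHS]quot_liftE [Q_to_L P i _]quot_liftE.
apply/esym/Lmap_cls; rewrite !corestrictE.
exact: fmap_comp2 _ (lift_m l i).
Qed.
End AtLifting.

Section ResFunctors.
Variable i : nat.

Section Indep.
Variables (B B' : lmodType R) (f : {linear B -> B'}).
Variables (P : resolution B) (P' : resolution B') (l l' : lifting f P P').

Fact Lmap_indep x : Lmap l i x = Lmap l' i x.
Proof.
apply: subquot_map_eq => v vZ.
have [u [s [_ sE uE]]] := lifting_homotopy l l' i.
have -> : fmap F (lift_P l i) v - fmap F (lift_P l' i) v =
    fmap F u (fmap F (res_e P i) v) + fmap F (pdiff P' i) (fmap F s v).
  rewrite (@fmap_ext _ F _ _ _ (lift_P l' i \+ ((u \o res_e P i) \+ (pdiff P' i \o s)))) //.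
  by rewrite !fmap_add !fmap_comp addrC addKr.
have -> : fmap F u (fmap F (res_e P i) v) = 0.
  case: i u v vZ uE {sE s} => [|j] u v vZ uE; first exact: fmap0.
  have [w wE] := uE; rewrite (@fmap_ext _ F _ _ _ (w \o res_m P j)) //.
  by rewrite fmap_comp -fmap_pdiff (kerpP _ _ vZ) raddf0.
by rewrite add0r; apply/impP; exists (fmap F s v).
Qed.

Fact Qmap_indep x : Qmap l i x = Qmap l' i x.
Proof.
have [v <-] := proj_surj x; rewrite ![LHS]quot_mapE [RHS]quot_mapE.
apply/eqP; rewrite -subr_eq0 -raddfB proj_eq0; apply/impP.
have [u [_ [uE _ _]]] := lifting_homotopy l l' i; exists (fmap F u v).
rewrite (@fmap_ext _ F _ _ (lift_Om l i) (lift_Om l' i \+ (res_e P' i \o u))) //.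
by rewrite fmap_add fmap_comp addrC addKr.
Qed.

Fact Smap_indep x : Smap l i x = Smap l' i x.
Proof.
apply: (@Sincl_inj _ P'); rewrite !SmapE.
have [u [_ [uE _ vE]]] := lifting_homotopy l l' i.
rewrite (@fmap_ext _ F _ _ (lift_Om l i) (lift_Om l' i \+ (res_e P' i \o u))) //.
rewrite fmap_add fmap_comp [X in _ + X](_ : _ = 0) ?addr0 //.
case: i u x vE {uE} => [|j] u x vE; first by rewrite [fmap F u _]fmap0 ?raddf0.
have [w wE] := vE; rewrite (@fmap_ext _ F _ _ u (w \o res_m P j)) //.
by rewrite fmap_comp (kerpP _ _ (inclP x)) !raddf0.
Qed.
End Indep.

Fact Lmap_id (B : lmodType R) (P : resolution B) x : Lmap (lifting_id P) i x = x.
Proof. by apply: subquot_map_id => v; exact: fmap_id. Qed.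

Fact Lmap_comp (B B' B'' : lmodType R) (g : {linear B' -> B''}) (f : {linear B -> B'})
    (P : resolution B) (P' : resolution B') (P'' : resolution B'')
    (lg : lifting g P' P'') (lf : lifting f P P') x :
  Lmap (lifting_comp lg lf) i x = Lmap lg i (Lmap lf i x).
Proof. by apply: subquot_map_comp => v; exact: fmap_comp. Qed.

Fact Lmap_add (B B' : lmodType R) (f g : {linear B -> B'})
    (P : resolution B) (P' : resolution B') (lf : lifting f P P') (lg : lifting g P P') x :
  Lmap (lifting_add lf lg) i x = Lmap lf i x + Lmap lg i x.
Proof. by apply: subquot_map_add => v; exact: fmap_add. Qed.

Fact Qmap_id (B : lmodType R) (P : resolution B) x : Qmap (lifting_id P) i x = x.
Proof. by have [v <-] := proj_surj x; rewrite [LHS]quot_mapE fmap_id. Qed.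

Fact Qmap_comp (B B' B'' : lmodType R) (g : {linear B' -> B''}) (f : {linear B -> B'})
    (P : resolution B) (P' : resolution B') (P'' : resolution B'')
    (lg : lifting g P' P'') (lf : lifting f P P') x :
  Qmap (lifting_comp lg lf) i x = Qmap lg i (Qmap lf i x).
Proof.
have [v <-] := proj_surj x.
by rewrite [LHS]quot_mapE [Qmap lf _ _]quot_mapE [RHS]quot_mapE fmap_comp.
Qed.

Fact Qmap_add (B B' : lmodType R) (f g : {linear B -> B'})
    (P : resolution B) (P' : resolution B') (lf : lifting f P P') (lg : lifting g P P') x :
  Qmap (lifting_add lf lg) i x = Qmap lf i x + Qmap lg i x.
Proof.
have [v <-] := proj_surj x.
by rewrite [LHS]quot_mapE [Qmap lf _ _]quot_mapE [Qmap lg _ _]quot_mapE fmap_add raddfD.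
Qed.

Fact Smap_id (B : lmodType R) (P : resolution B) x : Smap (lifting_id P) i x = x.
Proof. by apply: (@Sincl_inj _ P); rewrite SmapE [LHS]fmap_id. Qed.

Fact Smap_comp (B B' B'' : lmodType R) (g : {linear B' -> B''}) (f : {linear B -> B'})
    (P : resolution B) (P' : resolution B') (P'' : resolution B'')
    (lg : lifting g P' P'') (lf : lifting f P P') x :
  Smap (lifting_comp lg lf) i x = Smap lg i (Smap lf i x).
Proof. by apply: (@Sincl_inj _ P''); rewrite !SmapE [LHS]fmap_comp. Qed.

Fact Smap_add (B B' : lmodType R) (f g : {linear B -> B'})
    (P : resolution B) (P' : resolution B') (lf : lifting f P P') (lg : lifting g P P') x :
  Smap (lifting_add lf lg) i x = Smap lf i x + Smap lg i x.
Proof.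
by apply: (@Sincl_inj _ P'); rewrite (raddfD (Sincl P' i)) !SmapE [LHS]fmap_add.
Qed.

Definition Lres : resFunctor R := @ResFunctor R (fun B P => Lobj P i)
  (fun B B' f P P' l => Lmap l i) Lmap_id Lmap_comp Lmap_add Lmap_indep.
Definition Qres : resFunctor R := @ResFunctor R (fun B P => Qobj P i)
  (fun B B' f P P' l => Qmap l i) Qmap_id Qmap_comp Qmap_add Qmap_indep.
Definition Sres : resFunctor R := @ResFunctor R (fun B P => Sobj P i)
  (fun B B' f P P' l => Smap l i) Smap_id Smap_comp Smap_add Smap_indep.
End ResFunctors.

Variable res : forall B : lmodType R, resolution B.

Definition left_derived i : addFunctor R := descend res (Lres i).
Definition left_satellite i : addFunctor R := descend res (Sres i).
Definition quot_stab_Om i : addFunctor R := descend res (Qres i).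

Definition derived_to_satellite i : natTrans (left_derived i) (left_satellite i) :=
  @NatTrans R (left_derived i) (left_satellite i) (fun B => L_to_S (res B) i)
    (fun M N f => L_to_S_natural (reslift res f) (i := i)).
Definition satellite_to_stab i : natTrans (left_satellite i) (quot_stab_Om i) :=
  @NatTrans R (left_satellite i) (quot_stab_Om i) (fun B => S_to_Q (res B) i)
    (fun M N f => S_to_Q_natural (reslift res f) (i := i)).
Definition stab_to_derived i : natTrans (quot_stab_Om i.+1) (left_derived i) :=
  @NatTrans R (quot_stab_Om i.+1) (left_derived i) (fun B => Q_to_L (res B) i)
    (fun M N f => Q_to_L_natural (reslift res f) (i := i)).

Definition left_fundamental_sequence_exact :=
  forall B : lmodType R,
  [/\ forall i, exact_at (stab_to_derived i B) (derived_to_satellite i B),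
      forall i, exact_at (derived_to_satellite i B) (satellite_to_stab i B),
      forall i, exact_at (satellite_to_stab i.+1 B) (stab_to_derived i B) &
      forall y, exists x, satellite_to_stab 0 B x = y].
End FundamentalSequence.

(* Tor_i(A, -) is the i-th left derived functor of A ⊗ -. *)
Definition Tor (R : pzRingType) (res : forall B : lmodType R, resolution B)
    (i : nat) (A : lmodType R^c) : addFunctor R :=
  left_derived (tensor_functor A) res i.

(* Main.v *)
(* For any half exact F the fundamental sequence is exact, by a diagram chase; *)
(* H_n(C ⊗ -) is half exact because C is flat. If F moreover preserves        *)
(* epimorphisms, its quot-stabilization vanishes, so L_i F = S_i F; this      *)
(* applies to A ⊗ - and computes Tor_i(A, -) as a kernel. With F =            *)
(* H_n(C ⊗ -):                                                                *)
(* - F embeds naturally in (C_n/B_n) ⊗ -, and an element of (C_n/B_n) ⊗ M     *)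
(*   killed by some M -> N injective comes from F(M), since C_(n-1) is flat;  *)
(*   hence the satellites of both functors agree in positive degrees;         *)
(* - the connecting map H_n(C ⊗ Om i) -> H_(n-1)(C ⊗ Om (i+1)) identifies the *)
(*   cokernel of F(e i) with S_(i+1) H_(n-1)(C ⊗ -);                          *)
(* - H_n(C) ⊗ P = H_n(C ⊗ P) for P projective, as P is flat.                  *)
(* Maps that are naturally given by a diagram chase are built from their      *)
(* graphs, as total and functional additive relations.                        *)
From HB Require Import structures.
From mathcomp Require Import all_boot all_algebra.
From mathcomp Require Import boolp functions.
Require Import Defs.

Set Implicit Arguments.
Unset Strict Implicit.
Unset Printing Implicit Defensive.

Import GRing.Theory.
Local Open Scope ring_scope.

(** Put F = H_n(C ⊗ -). A short exact sequence of modules stays exact after tensoring with the flat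
    complex C, so F is half exact ([tensor_homology_half_exact]). This gives exactness of the
    fundamental sequence ([half_exact_fundamental_sequence]).

    For A ⊗ -, which preserves epimorphisms, the quot-stabilization vanishes, so Tor_i(A, -) is the
    satellite S_i(A ⊗ -) ([Tor_satellite_natiso]). All identifications with positive Tor of C_k/B_k
    pass through this kernel description.

    Satellites: F(M) is the kernel of (C_n/B_n) ⊗ M -> C_(n-1) ⊗ M. Flatness of C_(n-1) puts every
    element killed by a monomorphism M -> N in this kernel, so F and (C_n/B_n) ⊗ - have the same
    satellites in positive degrees ([satellite_homology_natiso]).

    Stabilization: in the long exact homology sequence of 0 -> Om (i+1) -> P i -> Om i -> 0, the
    connecting map identifies Coker F(e i) with the kernel of H_(n-1)(C ⊗ Om (i+1)) -> H_(n-1)(C ⊗ P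
    i), which is S_(i+1) H_(n-1)(C ⊗ -) ([stab_satellite_natiso]). The previous identification in
    degree n-1 turns it into Tor.

    Derived functors: they only see values on projectives. Projectives are flat ([projective_flat]),
    so there H_n(C) ⊗ - -> H_n(C ⊗ -) is bijective ([derived_homology_natiso]). *)

(** * Additive relations and natural isomorphisms *)

Lemma raddf_inj0 (V W : zmodType) (f : {additive V -> W}) :
  (forall x, f x = 0 -> x = 0) -> injective f.
Proof.
by move=> f0 x y fxy; apply/eqP; rewrite -subr_eq0; apply/eqP/f0; rewrite raddfB fxy subrr.
Qed.

Lemma inj_raddf0 (V W : zmodType) (f : {additive V -> W}) x :
  injective f -> f x = 0 -> x = 0.
Proof. by move=> fI fx; apply: fI; rewrite raddf0. Qed.

Lemma inj_surj_bijective (T U : Type) (f : T -> U) :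
  injective f -> (forall y, exists x, f x = y) -> bijective f.
Proof.
move=> fI fS; exists (fun y => sval (cid (fS y))) => [x|y].
  by apply: fI; exact: (svalP (cid (fS _))).
exact: (svalP (cid (fS y))).
Qed.

(** Two values at v differ by a value at 0, so single-valuedness need only be checked at 0. This
    lets a diagram chase define a map without tracking its choices. *)
Lemma additive_of_relation (V W : zmodType) (r : V -> W -> Prop) :
    (forall v w v' w', r v w -> r v' w' -> r (v - v') (w - w')) ->
    (forall v, exists w, r v w) -> (forall w, r 0 w -> w = 0) ->
  exists f : {additive V -> W}, forall v w, r v w <-> f v = w.
Proof.
move=> rB rT r0; pose f v := sval (cid (rT v)).
have rf v : r v (f v) by exact: (svalP (cid (rT v))).
have rE v w : r v w -> f v = w.
  move=> rvw; apply/eqP; rewrite -subr_eq0; apply/eqP/r0.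
  by rewrite -(subrr v); exact: rB.
have fB : zmod_morphism f by move=> u v; apply: rE; exact: rB.
pose fM := GRing.isZmodMorphism.Build _ _ f fB.
pose f' : {additive V -> W} := HB.pack f fM.
by exists f' => v w; split=> [/rE //|<-]; exact: rf.
Qed.

Section NaturalIsomorphisms.
Variable R : pzRingType.
Implicit Types F G H : addFunctor R.

Lemma natTrans_of_relation F G (r : forall M, F M -> G M -> Prop) :
    (forall M x y x' y', r M x y -> r M x' y' -> r M (x - x') (y - y')) ->
    (forall M x, exists y, r M x y) -> (forall M y, r M 0 y -> y = 0) ->
    (forall (M N : lmodType R) (f : {linear M -> N}) x y,
      r M x y -> r N (fmap F f x) (fmap G f y)) ->
  exists t : natTrans F G, forall M x y, r M x y <-> t M x = y.
Proof.
move=> rB rT r0 rN; pose tM M := cid (additive_of_relation (rB M) (rT M) (r0 M)).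
have tP M x y : r M x y <-> sval (tM M) x = y by exact: (svalP (tM M)).
have tN (M N : lmodType R) (f : {linear M -> N}) x :
    sval (tM N) (fmap F f x) = fmap G f (sval (tM M) x).
  by apply/tP/rN/tP.
by exists (@NatTrans R F G (fun M => sval (tM M)) tN).
Qed.

Lemma natiso_of_relation F G (r : forall M, F M -> G M -> Prop) :
    (forall M x y x' y', r M x y -> r M x' y' -> r M (x - x') (y - y')) ->
    (forall M x, exists y, r M x y) -> (forall M y, r M 0 y -> y = 0) ->
    (forall M y, exists x, r M x y) -> (forall M x, r M x 0 -> x = 0) ->
    (forall (M N : lmodType R) (f : {linear M -> N}) x y,
      r M x y -> r N (fmap F f x) (fmap G f y)) ->
  naturally_isomorphic F G.
Proof.
move=> rB rT r0 rS rI rN; have [t tP] := natTrans_of_relation rB rT r0 rN.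
exists t => M; apply: inj_surj_bijective => [|y].
  by apply: raddf_inj0 => x /tP/rI.
by have [x /tP] := rS M y; exists x.
Qed.

Lemma natiso_sym F G : naturally_isomorphic F G -> naturally_isomorphic G F.
Proof.
case=> t tb; have tI M := bij_inj (tb M).
apply: (natiso_of_relation (r := fun M y x => t M x = y)).
- by move=> M x y x' y' <- <-; rewrite raddfB.
- by move=> M y; have [u _ uK] := tb M; exists (u y); exact: uK.
- by move=> M x /inj_raddf0; apply; exact: tI.
- by move=> M x; exists (t M x).
- by move=> M _ <-; rewrite raddf0.
- by move=> M N f y x <-; rewrite nat_comm.
Qed.

Lemma natiso_trans F G H : naturally_isomorphic F G -> naturally_isomorphic G H ->
  naturally_isomorphic F H.
Proof.
case=> t tb [u ub].
have tuN (M N : lmodType R) (f : {linear M -> N}) x :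
    (u N \o t N : {additive _ -> _}) (fmap F f x) =
    fmap H f ((u M \o t M : {additive _ -> _}) x).
  by rewrite /= !nat_comm.
exists (@NatTrans R F H (fun M => u M \o t M) tuN) => M.
exact: (bij_comp (ub M) (tb M)).
Qed.
End NaturalIsomorphisms.

(** * Linear quotient maps, and right exactness of the tensor product *)

Section LinearQuotients.
Variables (R : pzRingType) (V : lmodType R) (S : submodule V).

Fact incl_linear : linear (incl S). Proof. by []. Qed.
Definition linincl : {linear subz S -> V} :=
  HB.pack (incl S : subz S -> V) (GRing.isLinear.Build _ _ _ _ _ incl_linear).

Fact proj_linear : linear (proj S).
Proof.
by move=> a x y; rewrite raddfD -(quot_scaleE S a x).
Qed.
Definition linproj : {linear V -> quotz S} :=
  HB.pack (proj S : V -> quotz S) (GRing.isLinear.Build _ _ _ _ _ proj_linear).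

Lemma linproj_eq0 v : linproj v = 0 <-> v \in S.
Proof. by rewrite -proj_eq0; split=> /eqP. Qed.
End LinearQuotients.

Section Tensors.
Variable R : pzRingType.
Implicit Types (A : lmodType R^c) (M : lmodType R).

(** The projection modulo S vanishes on pure tensors, hence is zero. *)
Lemma tensor_ind A M (S : zmodClosed (tensor A M)) :
  (forall a m, tens a m \in S) -> forall x, x \in S.
Proof.
move=> tS x; rewrite -proj_eq0; apply/eqP.
have /(_ x) : proj S =1 (\0 : {additive _ -> _}); last by [].
by apply: tensor_ext => a m; apply/eqP; rewrite proj_eq0.
Qed.

Lemma tens0l A M (m : M) : tens (0 : A) m = 0.
Proof. by apply: (@addrI _ (tens 0 m)); rewrite -tensDl !addr0. Qed.

Lemma tens0r A M (a : A) : tens a (0 : M) = 0.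
Proof. by apply: (@addrI _ (tens a 0)); rewrite -tensDr !addr0. Qed.

Lemma tensBl A M (a a' : A) (m : M) : tens (a - a') m = tens a m - tens a' m.
Proof. by apply: (@addIr _ (tens a' m)); rewrite -tensDl !subrK. Qed.

Lemma tensBr A M (a : A) (m m' : M) : tens a (m - m') = tens a m - tens a m'.
Proof. by apply: (@addIr _ (tens a m')); rewrite -tensDr !subrK. Qed.

Lemma tens_sumr A M (a : A) I (r : seq I) (h : I -> M) :
  tens a (\sum_(i <- r) h i) = \sum_(i <- r) tens a (h i).
Proof. exact: (big_morph (tens a) (@tensDr _ _ _ a) (tens0r M a)). Qed.

Section RightExact.
Variables (A A' : lmodType R^c) (M M' : lmodType R).
Variables (f : {linear A -> A'}) (g : {linear M -> M'}).
Hypothesis fS : forall y, exists x, f x = y.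
Hypothesis gS : forall y, exists x, g x = y.

Lemma tensor_map_surj y : exists x, tensor_map f g x = y.
Proof.
apply/(impP (tensor_map f g)); move: y.
apply: (tensor_ind (S := imz (tensor_map f g))) => a' m'.
have [[a <-] [m <-]] := (fS a', gS m').
by apply/impP; exists (tens a m); rewrite tensor_mapE.
Qed.

(* The kernel of f ⊗ g is generated by the a ⊗ m with f a = 0 or g m = 0:     *)
(* modulo such elements, a ⊗ m only depends on f a and g m.                   *)
Lemma tensor_map_ker (S : zmodClosed (tensor A M)) :
    (forall a m, f a = 0 -> tens a m \in S) ->
    (forall a m, g m = 0 -> tens a m \in S) ->
  forall x, tensor_map f g x = 0 -> x \in S.
Proof.
move=> Sf Sg.
have [[lf lfK] [lg lgK]] := (choice fS, choice gS).
pose b a' m' := proj S (tens (lf a') (lg m')).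
have bE a a' m m' : f a = f a' -> g m = g m' -> proj S (tens a m) = proj S (tens a' m').
  move=> faE gmE; apply/eqP; rewrite -subr_eq0 -raddfB proj_eq0.
  rewrite -[_ - _](subrKA (tens a m')) -tensBl -tensBr.
  by apply: rpredD; [apply: Sg; rewrite linearB gmE subrr |
    apply: Sf; rewrite linearB faE subrr].
have bDl a a' m : b (a + a') m = b a m + b a' m.
  by rewrite /b -raddfD -tensDl; apply: bE; rewrite ?linearD ?lfK.
have bDr a m m' : b a (m + m') = b a m + b a m'.
  by rewrite /b -raddfD -tensDr; apply: bE; rewrite ?linearD ?lgK.
have bZ a (r : R) m : b ((r : R^c) *: a) m = b a (r *: m).
  rewrite /b (bE _ ((r : R^c) *: lf a) _ (lg m)) ?linearZ ?lfK //=.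
  by rewrite tensZ; apply: bE; rewrite ?linearZ ?lgK.
have hE x : tensor_lift bDl bDr bZ (tensor_map f g x) = proj S x.
  move: x; apply: (tensor_ext (f := tensor_lift bDl bDr bZ \o tensor_map f g)).
  by move=> a m; rewrite /= tensor_mapE tensor_liftE; apply: bE; rewrite ?lfK ?lgK.
by move=> x x0; rewrite -proj_eq0 -hE x0 raddf0.
Qed.
End RightExact.

Lemma tensor_exactr A M M' M'' (g : {linear M -> M'}) (p : {linear M' -> M''}) :
    (forall y, exists x, p x = y) -> exact_at g p ->
  exact_at (tensor_map (@idfun A) g) (tensor_map (@idfun A) p).
Proof.
move=> pS gp y; split=> [y0|[x <-]].
  apply/impP; apply: (tensor_map_ker (f := @idfun A) (g := p) _ _ _ _ y0) => //.
  - by move=> a; exists a.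
  - by move=> a m /= ->; rewrite tens0l rpred0.
  by move=> a m /gp[x <-]; apply/impP; exists (tens a x); rewrite tensor_mapE.
rewrite -tensor_map_compr; move: x.
apply: (tensor_ext (g := \0)) => a m; rewrite tensor_mapE /=.
by rewrite (proj2 (gp (g m))) ?tens0r //; exists m.
Qed.

Lemma tensor_exactl A A' A'' M (g : {linear A -> A'}) (p : {linear A' -> A''}) :
    (forall y, exists x, p x = y) -> exact_at g p ->
  exact_at (tensor_map g (@idfun M)) (tensor_map p (@idfun M)).
Proof.
move=> pS gp y; split=> [y0|[x <-]].
  apply/impP; apply: (tensor_map_ker (f := p) (g := @idfun M) _ _ _ _ y0) => //.
  - by move=> a; exists a.
  - by move=> a m /gp[x <-]; apply/impP; exists (tens x m); rewrite tensor_mapE.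
  by move=> a m /= ->; rewrite tens0r rpred0.
move: x; apply: (tensor_ext (f := tensor_map p idfun \o tensor_map g idfun) (g := \0)).
move=> a m; rewrite /= !tensor_mapE.
by rewrite (proj2 (gp (g a))) ?tens0l //; exists a.
Qed.
End Tensors.

(** * Free modules, and flatness of projective modules *)

Section FreeModule.
Variables (R : pzRingType) (X : choiceType).

(** The sequence need only contain the support. Sums over it are therefore shown not to depend on
    which one is taken. *)
Definition finsupp : {pred X -> R^o} :=
  [pred h | `[< exists s : seq X, forall x, x \notin s -> h x = 0 >]].

Lemma finsuppP (h : X -> R^o) :
  reflect (exists s : seq X, forall x, x \notin s -> h x = 0) (h \in finsupp).
Proof. exact: asboolP. Qed.

Fact finsupp_submod : GRing.submod_closed finsupp.
Proof.
split=> [|a h k /finsuppP[s sh] /finsuppP[t tk]]; apply/finsuppP.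
  by exists [::].
exists (s ++ t) => x; rewrite mem_cat negb_or => /andP[xs xt].
change (a * (h x : R) + (k x : R) = 0).
by rewrite sh // tk // mulr0 addr0.
Qed.

Definition freemod : lmodType R := subz (Submodule finsupp_submod).

Definition fcoef (x : X) (h : freemod) : R := incl (Submodule finsupp_submod) h x.

Lemma fcoef_ext h k : (forall x, fcoef x h = fcoef x k) -> h = k.
Proof. by move=> hk; apply: incl_inj; apply/funext => x; exact: hk. Qed.

Lemma fcoefD x h k : fcoef x (h + k) = fcoef x h + fcoef x k.
Proof. by []. Qed.

Lemma fcoef0 x : fcoef x 0 = 0. Proof. by []. Qed.

Lemma fcoefZ x a h : fcoef x (a *: h) = a * fcoef x h.
Proof. by []. Qed.

Lemma fcoef_sum x I (r : seq I) (h : I -> freemod) :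
  fcoef x (\sum_(i <- r) h i) = \sum_(i <- r) fcoef x (h i).
Proof. exact: (big_morph (fcoef x) (fcoefD x) (fcoef0 x)). Qed.

Fact fdelta_subproof x : (fun y => (y == x)%:R : R^o) \in smod_zmod (Submodule finsupp_submod).
Proof.
by apply/finsuppP; exists [:: x] => y; rewrite inE => /negPf ->.
Qed.
Definition fdelta x : freemod := sval (cid (subz_ex (fdelta_subproof x))).

Lemma fcoef_delta x y : fcoef x (fdelta y) = (x == y)%:R.
Proof. by rewrite /fcoef (svalP (cid (subz_ex (fdelta_subproof y)))). Qed.

Lemma fsupp_ex (h : freemod) :
  exists s : seq X, uniq s /\ forall x, x \notin s -> fcoef x h = 0.
Proof.
have /finsuppP[s hs] := inclP h.
by exists (undup s); rewrite undup_uniq; split=> // x; rewrite mem_undup; exact: hs.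
Qed.

Lemma freemod_decomp (h : freemod) (s : seq X) : uniq s ->
  (forall x, x \notin s -> fcoef x h = 0) -> h = \sum_(x <- s) fcoef x h *: fdelta x.
Proof.
move=> us hs; apply: fcoef_ext => x; rewrite fcoef_sum.
under eq_bigr do rewrite fcoefZ fcoef_delta.
have [xs|xs] := boolP (x \in s); last first.
  rewrite hs // big_seq big1 // => y ys.
  by case: eqP xs ys => [-> /negPf ->|]; rewrite ?mulr0.
rewrite (bigD1_seq x) //= eqxx mulr1 big1 ?addr0 // => y yx.
by rewrite eq_sym (negPf yx) mulr0.
Qed.

Section Universal.
Variables (M : lmodType R) (b : X -> M).

Definition fextend_fun (h : freemod) : M :=
  \sum_(x <- sval (cid (fsupp_ex h))) fcoef x h *: b x.

(** Once the zero coefficients are dropped, two such sequences are permutations of each other. *)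
Lemma fextend_funE (h : freemod) (s : seq X) : uniq s ->
  (forall x, x \notin s -> fcoef x h = 0) ->
  fextend_fun h = \sum_(x <- s) fcoef x h *: b x.
Proof.
have big_supp t : \sum_(x <- t) fcoef x h *: b x =
    \sum_(x <- [seq x <- t | fcoef x h != 0]) fcoef x h *: b x.
  rewrite big_filter [RHS]big_mkcond; apply: eq_bigr => x _.
  by case: eqP => //= ->; rewrite scale0r.
move=> us hs; rewrite /fextend_fun.
case: (cid _) => t [/= ut ht]; rewrite big_supp [RHS]big_supp.
apply/perm_big/uniq_perm; rewrite ?filter_uniq // => x; rewrite !mem_filter.
case: eqP => //= hx; have [xs|/hs //] := boolP (x \in s).
by have [xt|/ht //] := boolP (x \in t).
Qed.

Fact fextend_linear : linear fextend_fun.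
Proof.
move=> a h k; have [[s [us hs]] [t [ut kt]]] := (fsupp_ex h, fsupp_ex k).
rewrite !(@fextend_funE _ (undup (s ++ t))) ?undup_uniq //; first last.
1-3: move=> x; rewrite mem_undup mem_cat negb_or => /andP[xs xt].
- by rewrite fcoefD fcoefZ hs // kt // mulr0 addr0.
- by rewrite hs.
- by rewrite kt.
rewrite scaler_sumr -big_split; apply: eq_bigr => x _ /=.
by rewrite fcoefD fcoefZ scalerDl scalerA.
Qed.

Definition fextend : {linear freemod -> M} :=
  HB.pack fextend_fun (GRing.isLinear.Build _ _ _ _ _ fextend_linear).

Lemma fextend_delta x : fextend (fdelta x) = b x.
Proof.
rewrite [LHS](@fextend_funE _ [:: x]) // => [|y].
  by rewrite big_seq1 fcoef_delta eqxx scale1r.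
by rewrite inE fcoef_delta => /negPf ->.
Qed.
End Universal.
End FreeModule.
Arguments fdelta R {X} x.

Section Flatness.
Variable R : pzRingType.
Implicit Types (A : lmodType R^c).

Section Coordinate.
Variables (X : choiceType) (A : lmodType R^c).

Definition tcoef_bil x (a : A) (h : freemod R X) : A := (fcoef x h : R^c) *: a.
Fact tcoef_bilDl x a a' h : tcoef_bil x (a + a') h = tcoef_bil x a h + tcoef_bil x a' h.
Proof. exact: scalerDr. Qed.
Fact tcoef_bilDr x a h h' : tcoef_bil x a (h + h') = tcoef_bil x a h + tcoef_bil x a h'.
Proof. exact: (scalerDl a (fcoef x h : R^c)). Qed.
Fact tcoef_bilZ x a (r : R) h :
  tcoef_bil x ((r : R^c) *: a) h = tcoef_bil x a (r *: h).
Proof.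
rewrite /tcoef_bil fcoefZ; exact: (scalerA (fcoef x h : R^c) (r : R^c) a).
Qed.

(** The x-coordinate under the identification of A ⊗ R^(X) with the direct sum of copies of A. *)
Definition tcoef x : {additive tensor A (freemod R X) -> A} :=
  tensor_lift (tcoef_bilDl x) (tcoef_bilDr x) (@tcoef_bilZ x).

Lemma tcoefE x a h : tcoef x (tens a h) = (fcoef x h : R^c) *: a.
Proof. exact: tensor_liftE. Qed.

Lemma tensor_free_decomp (t : tensor A (freemod R X)) :
  exists s : seq X, t = \sum_(x <- s) tens (tcoef x t) (fdelta R x).
Proof.
pose D (s : seq X) (t : tensor A (freemod R X)) := \sum_(x <- s) tens (tcoef x t) (fdelta R x).
(* Asking for all larger sequences makes the property closed under subtraction: two elements share
   the concatenation of their bounds. *)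
pose ok (t : tensor A (freemod R X)) := exists s0 : seq X,
  forall s, uniq s -> {subset s0 <= s} -> t = D s t.
suff: ok t.
  case=> s0 /(_ (undup s0)); rewrite undup_uniq => ts; exists (undup s0); apply: ts => //.
  by move=> x; rewrite mem_undup.
pose S : {pred tensor A (freemod R X)} := [pred t | `[< ok t >]].
have DB s u v : D s (u - v) = D s u - D s v.
  by rewrite /D -sumrB; apply: eq_bigr => x _; rewrite raddfB tensBl.
have SC : zmod_closed S.
  split=> [|u v /asboolP[s us] /asboolP[s' vs]]; apply/asboolP.
    by exists [::] => s _ _; rewrite /D big1 // => x _; rewrite raddf0 tens0l.
  exists (s ++ s') => s1 us1 ss1; rewrite DB -us -?vs // => x xs; apply: ss1.
    by rewrite mem_cat xs orbT.
  by rewrite mem_cat xs.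
pose SM := GRing.isZmodClosed.Build _ S SC.
pose S' : zmodClosed (tensor A (freemod R X)) := HB.pack S SM.
apply/asboolP; apply: (tensor_ind (S := S')) => a h; apply/asboolP.
have [s0 [us0 hs0]] := fsupp_ex h; exists s0 => s us ss.
have hE : h = \sum_(x <- s) fcoef x h *: fdelta R x.
  by apply: freemod_decomp us _ => x xs; apply: hs0; apply: contra xs; exact: ss.
rewrite /D {1}hE.
by rewrite tens_sumr; apply: eq_bigr => x _; rewrite tcoefE tensZ.
Qed.
End Coordinate.
Arguments tcoef {X A} x.

Lemma tcoef_map (X : choiceType) A A' (f : {linear A -> A'}) (x : X)
    (t : tensor A (freemod R X)) :
  tcoef x (tensor_map f idfun t) = f (tcoef x t).
Proof.
move: t; apply: (tensor_ext (f := tcoef x \o tensor_map f idfun) (g := f \o tcoef x)).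
by move=> a h; rewrite /= tensor_mapE !tcoefE linearZ.
Qed.

(** The coordinates determine t, and f ⊗ 1 acts on them through f. *)
Lemma freemod_flat (X : choiceType) A A' (f : {linear A -> A'}) :
  injective f -> injective (tensor_map f (@idfun (freemod R X))).
Proof.
move=> fI; apply: raddf_inj0 => t t0.
have [s ->] := tensor_free_decomp t; apply: big1 => x _.
have -> : tcoef x t = 0.
  by apply: (inj_raddf0 fI); apply: etrans (esym (tcoef_map f x t)) _; rewrite t0 raddf0.
exact: tens0l.
Qed.

(** P is a retract of the free module on its own underlying set, and injectivity passes to
    retracts. *)
Lemma projective_flat (P : lmodType R) A A' (f : {linear A -> A'}) :
  projective P -> injective f -> injective (tensor_map f (@idfun P)).
Proof.
move=> Pproj fI; pose p : {linear freemod R P -> P} := fextend idfun.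
have [y|s sK] := Pproj _ _ p idfun; first by exists (fdelta R y); exact: fextend_delta.
apply: raddf_inj0 => t t0.
have : tensor_map (@idfun A) s t = 0.
  apply: (inj_raddf0 (freemod_flat fI)).
  by rewrite tensor_map_xchg t0 raddf0.
move/(congr1 (tensor_map (@idfun A) p)); rewrite raddf0 -tensor_map_compr => <-.
rewrite -[LHS]tensor_map_id; congr (tensor_map _ _ t).
by apply: linear_ext => x; exact: esym (sK x).
Qed.
End Flatness.

(** * The fundamental sequence of a half exact functor *)

Lemma cls_eq0 (V : zmodType) (Z B : zmodClosed V) (x : subz Z) :
  cls Z B x = 0 <-> incl Z x \in B.
Proof. by rewrite -restrE -proj_eq0; split=> /eqP. Qed.

Lemma fmap_m_Sincl (R : pzRingType) (F : addFunctor R) (B : lmodType R) (P : resolution B) i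
    (s : Sobj F P i.+1) : fmap F (res_m P i) (Sincl F P i.+1 s) = 0.
Proof. exact: (kerpP _ _ (inclP s)). Qed.

Section HalfExact.
Variables (R : pzRingType) (F : addFunctor R).

Definition half_exact := forall (M M' M'' : lmodType R)
    (g : {linear M -> M'}) (p : {linear M' -> M''}),
  injective g -> (forall y, exists x, p x = y) -> exact_at g p ->
  exact_at (fmap F g) (fmap F p).

Definition preserves_epi := forall (M M' : lmodType R) (p : {linear M -> M'}),
  (forall y, exists x, p x = y) -> forall y, exists x, fmap F p x = y.

(** Half exactness enters at L_i F, through exactness of F(Om (i+1)) -> F(P i) -> F(Om i). At the
    other terms the chase is formal, from F(∂) = F(m) F(e) and F(e) F(m) = 0. *)
Lemma half_exact_fundamental_sequence (res : forall B : lmodType R, resolution B) :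
  half_exact -> left_fundamental_sequence_exact F res.
Proof.
move=> Fex B; set P := res B; split=> [i y|i y|i y|y].
- split=> [|[x <-]].
    have [z <-] := cls_surj y => /= z0.
    have /(proj1 (Fex _ _ _ _ _ (res_m_inj P i) (res_e_surj P i) (res_exact P i) _)) :
        fmap F (res_e P i) (incl (Fcycles F P i) z) = 0.
      rewrite -cycles_to_SE -[RHS](raddf0 (Sincl F P i)); congr (Sincl F P i _).
      by rewrite -z0 [RHS]quot_liftE.
    case=> v vE; exists (proj _ v); rewrite [LHS]quot_liftE.
    by apply: cls_eq; rewrite corestrictE vE subrr rpred0.
  have [v <-] := proj_surj x; rewrite /= [Q_to_L _ _ _ _]quot_liftE [LHS]quot_liftE.
  by apply: (@Sincl_inj _ F _ P i); rewrite cycles_to_SE corestrictE fmap_em raddf0.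
- split=> [/eqP|[x <-]].
    rewrite [_ == 0]proj_eq0 => /impP[u uE].
    have uZ : u \in Fcycles F P i.
      case: i y u uE => [|j] y u uE //; apply/kerpP.
      by rewrite fmap_pdiff uE; exact: (kerpP _ _ (inclP y)).
    have [z zE] := subz_ex uZ; exists (cls _ _ z); rewrite [LHS]quot_liftE.
    by apply: (@Sincl_inj _ F _ P i); rewrite cycles_to_SE zE.
  have [z <-] := cls_surj x; rewrite /= [L_to_S _ _ _ _]quot_liftE.
  apply/eqP; rewrite [_ == 0]proj_eq0 cycles_to_SE; apply/impP.
  by exists (incl (Fcycles F P i) z).
- split=> [|[x <-]].
    have [v <-] := proj_surj y; rewrite [LHS]quot_liftE => /cls_eq0.
    rewrite corestrictE => /impP[u uE].
    (* F(m) v is the boundary F(∂) u = F(m) F(e) u, so this representative of the class of v lies in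
       the satellite. *)
    have vu : v - fmap F (res_e P i.+1) u \in kerz (fmap F (res_m P i)).
      by apply/kerpP; rewrite raddfB -fmap_pdiff uE subrr.
    have [s sE] := subz_ex vu; exists s.
    apply: etrans (congr1 (proj (imz (fmap F (res_e P i.+1)))) sE) _.
    apply/eqP; rewrite -subr_eq0 -raddfB proj_eq0 addrAC subrr add0r.
    by rewrite rpredN; apply/impP; exists u.
  rewrite [LHS]quot_liftE; apply/cls_eq0; rewrite corestrictE.
  by rewrite (kerpP _ _ (inclP x)) rpred0.
have [v <-] := proj_surj y; by exists v.
Qed.

Lemma derived_satellite_natiso (res : forall B : lmodType R, resolution B) i :
  half_exact -> preserves_epi ->
  naturally_isomorphic (left_derived F res i) (left_satellite F res i).
Proof.
move=> Fex Fepi; exists (derived_to_satellite F res i) => B.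
have [LS SQ _ _] := half_exact_fundamental_sequence res Fex B.
have Q0 j (q : Qobj F (res B) j) : q = 0.
  have [v <-] := proj_surj q; apply/eqP; rewrite proj_eq0; apply/impP.
  exact: Fepi (res_e_surj (res B) j) v.
apply: inj_surj_bijective => [|y].
  by apply: raddf_inj0 => x /LS[q <-]; rewrite (Q0 _ q) raddf0.
by apply/SQ; exact: Q0.
Qed.
End HalfExact.

(** * Comparing derived functors and satellites along a natural transformation *)

Section Transfer.
Variables (R : pzRingType) (F G : addFunctor R) (t : natTrans F G).
Variable res : forall B : lmodType R, resolution B.

Lemma natTrans_cycles (B : lmodType R) (P : resolution B) i x :
  x \in Fcycles F P i -> t _ x \in Fcycles G P i.
Proof.
by case: i x => [|i] x // /kerpP x0; apply/kerpP; rewrite -nat_comm x0 raddf0.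
Qed.

(** L_i is computed from values on the projectives P j alone; injectivity of t there reflects cycles
    and boundaries, and surjectivity lifts them. *)
Lemma left_derived_natiso i :
  (forall P : lmodType R, projective P -> bijective (t P)) ->
  naturally_isomorphic (left_derived F res i) (left_derived G res i).
Proof.
move=> tb.
have tbP B j := tb _ (proj_of_projective (res B) j).
have tI B j := bij_inj (tbP B j).
have tS B j y : exists x, t (proj_of (res B) j) x = y.
  by have [u _ uK] := tbP B j; exists (u y); exact: uK.
pose r B (x : Lobj F (res B) i) (y : Lobj G (res B) i) := exists u v,
  [/\ x = cls _ _ u, y = cls _ _ v & incl _ v = t _ (incl _ u)].
apply: (@natiso_of_relation _ (left_derived F res i) (left_derived G res i) r).
- move=> B _ _ _ _ [u [v [-> -> vu]]] [u' [v' [-> -> vu']]].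
  by exists (u - u'), (v - v'); rewrite !raddfB vu vu'.
- move=> B x; have [u <-] := cls_surj x.
  have [v vE] := subz_ex (natTrans_cycles (inclP u)).
  by exists (cls _ _ v), u, v.
- move=> B _ [u [v [/esym/cls_eq0/impP[w wE] -> vE]]].
  apply/cls_eq0; rewrite vE -wE; apply/impP.
  by exists (t _ w); rewrite nat_comm.
- move=> B y; have [v <-] := cls_surj y.
  have [u0 u0E] := tS B i (incl _ v).
  have uZ : u0 \in Fcycles F (res B) i.
    case: i u0 v {y r} u0E => [|j] u0 v u0E //; apply/kerpP.
    apply: (inj_raddf0 (tI B j)); rewrite nat_comm u0E.
    exact: (kerpP _ _ (inclP v)).
  by have [u uE] := subz_ex uZ; exists (cls _ _ u), u, v; rewrite uE u0E.
- move=> B _ [u [v [-> /esym/cls_eq0/impP[w wE] vE]]].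
  have [w' w'E] := tS B i.+1 w; apply/cls_eq0/impP; exists w'.
  by apply: (tI B i); rewrite nat_comm w'E wE.
move=> M N f _ _ [u [v [-> -> vE]]] /=.
rewrite ![Lmap _ _ _ _]subquot_mapE; do 2!eexists; split=> //.
by rewrite !sub_mapE nat_comm vE.
Qed.

(** The second hypothesis, at the monomorphism m i, says that Ker G(m i) lies in the image of t;
    injectivity of t then identifies it with Ker F(m i). *)
Lemma left_satellite_natiso i :
    (forall M, injective (t M)) ->
    (forall (M N : lmodType R) (m : {linear M -> N}) y, injective m ->
      fmap G m y = 0 -> exists x, t M x = y) ->
  naturally_isomorphic (left_satellite F res i.+1) (left_satellite G res i.+1).
Proof.
move=> tI tS.
pose r B (x : Sobj F (res B) i.+1) (y : Sobj G (res B) i.+1) :=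
  Sincl _ _ _ y = t _ (Sincl _ _ _ x).
have mI B := res_m_inj (res B) i.
apply: (@natiso_of_relation _ (left_satellite F res i.+1)
  (left_satellite G res i.+1) r); rewrite /r.
- by move=> B x y x' y' xy x'y'; rewrite !raddfB xy x'y'.
- move=> B x.
  have : t _ (incl _ x) \in kerz (fmap G (res_m (res B) i)).
    by apply/kerpP; rewrite -nat_comm (kerpP _ _ (inclP x)) raddf0.
  by case/subz_ex=> y yE; exists y.
- by move=> B y; rewrite !raddf0 => y0; apply: (@Sincl_inj _ G _ (res B)); rewrite y0 raddf0.
- move=> B y; have /kerpP my := inclP y.
  have [x0 x0E] := tS _ _ _ _ (mI B) my.
  have : x0 \in kerz (fmap F (res_m (res B) i)).
    by apply/kerpP; apply: tI; rewrite nat_comm x0E my raddf0.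
  by case/subz_ex=> x xE; exists x; apply: etrans (esym x0E) (congr1 _ (esym xE)).
- move=> B x; rewrite raddf0 => /esym x0.
  by apply: (@Sincl_inj _ F _ (res B)); rewrite (inj_raddf0 (tI _) x0) raddf0.
move=> M N f x y xy; pose l := reslift res f.
apply: etrans (@SmapE _ G _ _ _ _ _ l i.+1 y) _.
apply: etrans _ (congr1 (t _) (esym (@SmapE _ F _ _ _ _ _ l i.+1 x))).
by rewrite nat_comm; congr (fmap G _ _).
Qed.
End Transfer.

Lemma satellite0_natiso (R : pzRingType) (F : addFunctor R)
    (res : forall B : lmodType R, resolution B) :
  naturally_isomorphic (left_satellite F res 0) F.
Proof.
exists (@NatTrans R (left_satellite F res 0) F (fun B => idfun) (fun _ _ _ _ => erefl)).
by move=> M; exists id.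
Qed.

(** * Tor as a satellite of the tensor product *)

Section TensorFunctor.
Variables (R : pzRingType) (A : lmodType R^c).

Lemma tensor_functor_half_exact : half_exact (tensor_functor A).
Proof. by move=> M M' M'' g p _; exact: tensor_exactr. Qed.

Lemma tensor_functor_epi : preserves_epi (tensor_functor A).
Proof. by move=> M M' p pS; apply: tensor_map_surj => // a; exists a. Qed.

Lemma Tor_satellite_natiso (res : forall B : lmodType R, resolution B) i :
  naturally_isomorphic (Tor res i A) (left_satellite (tensor_functor A) res i).
Proof.
exact: derived_satellite_natiso tensor_functor_half_exact tensor_functor_epi.
Qed.
End TensorFunctor.

Section Corestriction.
Variables (R : pzRingType) (V W : lmodType R) (f : {linear V -> W}) (S : submodule W).
Hypothesis fS : forall x, f x \in smod_zmod S.

Fact lincorestrict_linear : linear (corestrict fS : V -> subz S).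
Proof.
move=> a x y; apply: (@incl_inj _ S); apply: etrans (corestrictE fS _) _.
exact: (linearP f a x y).
Qed.
Definition lincorestrict : {linear V -> subz S} :=
  HB.pack (corestrict fS : V -> subz S)
    (GRing.isLinear.Build _ _ _ _ _ lincorestrict_linear).

Lemma lincorestrictE x : linincl S (lincorestrict x) = f x.
Proof. exact: (corestrictE fS x). Qed.
End Corestriction.

(** * Half exactness of H_n(C ⊗ -) *)

Section Complex.
Variables (R : pzRingType) (C : chain_complex R^c).
Implicit Types M N : lmodType R.

Local Notation F := (tensor_homology_functor C).
Local Notation d M i j := (tensor_diff C M i j).
Local Notation "1⊗ g" := (tensor_map idfun g) (at level 10, g at level 9).

Lemma tensor_diff_diff M i j k x : d M j k (d M i j x) = 0.
Proof.
move: x; apply: (tensor_ext (f := d M j k \o d M i j) (g := \0)) => a m.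
by rewrite /= !tensor_mapE diff_comp tens0l.
Qed.

Lemma tensor_diff_map M N i j (g : {linear M -> N}) x :
  d N i j (1⊗ g x) = 1⊗ g (d M i j x).
Proof. exact: tensor_map_xchg. Qed.

(** The free index i allows i = n with j = n - 1, where n and n - 1 + 1 are equal but not
    convertible. *)
Lemma tensor_boundariesP M i j x : i = j + 1 ->
  (x \in tensor_boundaries C j M) <-> exists z, d M i j z = x.
Proof. by move=> ->; split=> [/impP //|?]; exact/impP. Qed.

Lemma homology_class_eq M n (x y : subz (tensor_cycles C n M)) z :
  incl _ x = incl _ y + d M (n + 1) n z ->
  cls _ (tensor_boundaries C n M) x = cls _ (tensor_boundaries C n M) y.
Proof.
by move=> xy; apply: cls_eq; rewrite xy addrAC subrr add0r; apply/impP; exists z.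
Qed.

Lemma homology_map_cls M N n (g : {linear M -> N}) x y :
  incl _ y = 1⊗ g (incl _ x) -> fmap (F n) g (cls _ _ x) = cls _ _ y.
Proof.
move=> yx; rewrite [LHS]subquot_mapE; apply: cls_eq.
by rewrite sub_mapE yx subrr rpred0.
Qed.

Section FlatComplex.
Hypothesis C_flat : forall k : int, flat (C k).

(** If the cycle x becomes the boundary of w, lift w to w' and subtract its boundary: x - d w' comes
    from some v over M, which is a cycle because C_(n-1) ⊗ g is injective. *)
Lemma tensor_homology_half_exact n : half_exact (F n).
Proof.
move=> M M' M'' g p gI pS gp y; split=> [|[x <-]]; last first.
  by rewrite -fmap_comp fmap0 // => v; apply/gp; exists v.
have [x <-] := cls_surj y; rewrite [fmap _ _ _]subquot_mapE => /cls_eq0.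
rewrite sub_mapE => /impP[w wE].
have [w' w'E] := tensor_functor_epi (A := C (n + 1)) pS w.
have /(tensor_exactr pS gp)[v vE] : 1⊗ p (incl _ x - d M' (n + 1) n w') = 0.
  by rewrite raddfB -tensor_diff_map [1⊗ p w']w'E wE subrr.
have vZ : v \in tensor_cycles C n M.
  apply/kerpP; apply: (inj_raddf0 (C_flat gI)).
  rewrite [LHS](esym (tensor_diff_map _ _ _)) vE raddfB tensor_diff_diff subr0.
  exact: (kerpP _ _ (inclP x)).
have [u uE] := subz_ex vZ; exists (cls _ _ u).
rewrite [LHS]subquot_mapE; apply: (homology_class_eq (z := - w')).
by rewrite sub_mapE uE vE raddfN.
Qed.

(** * Satellites of H_n(C ⊗ -), by embedding it in (C_n/B_n) ⊗ - *)

Section ChainModBoundaries.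
Variable n : int.

Let p : {linear C n -> chain_mod_boundaries C n} := linproj (boundaries C n).

Fact proj_boundaries_surj y : exists x, p x = y. Proof. exact: proj_surj. Qed.

Fact proj_boundaries_exact : exact_at (diff C (n + 1) n) p.
Proof. by move=> y; split=> [/linproj_eq0/impP //|?]; apply/linproj_eq0/impP. Qed.

(** Right exactness of - ⊗ M applied to C_(n+1) -> C_n -> C_n/B_n -> 0. This is what makes
    [homology_to_quot] well defined and injective. *)
Fact tensor_boundariesE M x :
  x \in tensor_boundaries C n M <-> tensor_map p idfun x = 0.
Proof.
split=> [/impP ?|x0]; last apply/impP.
  exact/(tensor_exactl proj_boundaries_surj proj_boundaries_exact).
exact/(tensor_exactl proj_boundaries_surj proj_boundaries_exact).
Qed.

Fact homology_to_quot_subproof M x :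
  x \in restr (tensor_cycles C n M) (tensor_boundaries C n M) ->
  (tensor_map p idfun \o incl _) x = 0.
Proof. by rewrite restrE => /tensor_boundariesE. Qed.

Definition homology_to_quot_fun M : {additive F n M -> tensor (chain_mod_boundaries C n) M} :=
  quot_lift (@homology_to_quot_subproof M).

Fact homology_to_quot_natural M N (g : {linear M -> N}) x :
  homology_to_quot_fun N (fmap (F n) g x) = 1⊗ g (homology_to_quot_fun M x).
Proof.
have [u <-] := cls_surj x; rewrite [fmap _ _ _]subquot_mapE.
rewrite [LHS]quot_liftE [homology_to_quot_fun _ _]quot_liftE.
apply: etrans (congr1 (tensor_map p idfun) (sub_mapE _ u)) _.
exact: tensor_map_xchg.
Qed.

Definition homology_to_quot : natTrans (F n) (tensor_functor (chain_mod_boundaries C n)) :=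
  @NatTrans R (F n) (tensor_functor (chain_mod_boundaries C n))
    homology_to_quot_fun homology_to_quot_natural.

Lemma satellite_homology_natiso (res : forall B : lmodType R, resolution B) i :
  naturally_isomorphic (left_satellite (F n) res i.+1)
    (Tor res i.+1 (chain_mod_boundaries C n)).
Proof.
apply: natiso_trans (natiso_sym (Tor_satellite_natiso _ _ _)).
apply: (left_satellite_natiso (t := homology_to_quot)) => [M|M N m y mI].
  apply: raddf_inj0 => x; have [u <-] := cls_surj x.
  rewrite [homology_to_quot _ _]quot_liftE => u0.
  by apply/cls_eq0/tensor_boundariesE.
have [c <-] := tensor_map_surj proj_boundaries_surj
  (fun m : M => ex_intro (fun x => idfun x = m) m erefl) y.
rewrite [fmap _ _ _](esym (tensor_map_xchg _ _ _)) => /tensor_boundariesE/impP[z zE].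
(* After applying m, c is a boundary, so m kills d c; as C_(n-1) ⊗ m is injective, d c = 0. *)
have cZ : c \in tensor_cycles C n M.
  apply/kerpP; apply: (inj_raddf0 (C_flat mI)).
  by rewrite [LHS](esym (tensor_diff_map _ _ _)) -zE tensor_diff_diff.
by have [u uE] := subz_ex cZ; exists (cls _ _ u); rewrite [LHS]quot_liftE -uE.
Qed.
End ChainModBoundaries.

(** * Quot-stabilization through the connecting map *)

Section Connecting.
Variables (n : int) (res : forall B : lmodType R, resolution B) (i : nat).

(* The graph of the connecting map H_n(C ⊗ Om i) -> H_(n-1)(C ⊗ Om (i+1)) of  *)
(* 0 -> Om (i+1) -> P i -> Om i -> 0.                                         *)
Definition connecting (B : lmodType R)
    (q : Qobj (F n) (res B) i) (s : Sobj (F (n - 1)) (res B) i.+1) :=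
  exists c x y, [/\ q = proj _ (cls _ _ x), Sincl _ _ _ s = cls _ _ y,
    incl (tensor_cycles C n _) x = 1⊗ (res_e (res B) i) c &
    1⊗ (res_m (res B) i) (incl (tensor_cycles C (n - 1) _) y) = d _ n (n - 1) c].

Let eS (B : lmodType R) j := tensor_functor_epi (A := C j) (res_e_surj (res B) i).
Let em (B : lmodType R) j :=
  @tensor_exactr R (C j) _ _ _ _ _ (res_e_surj (res B) i) (res_exact (res B) i).
Let mI (B : lmodType R) j := C_flat (k := j) (res_m_inj (res B) i).

Let n1 : n = n - 1 + 1. Proof. by rewrite subrK. Qed.

Fact connecting_sub (B : lmodType R) q s q' s' :
  @connecting B q s -> connecting q' s' -> connecting (q - q') (s - s').
Proof.
case=> c [x [y [-> sE xE yE]]] [c' [x' [y' [-> s'E x'E y'E]]]].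
by exists (c - c'), (x - x'), (y - y'); rewrite !raddfB sE s'E xE x'E yE y'E.
Qed.

Fact connecting_total (B : lmodType R) q : exists s, @connecting B q s.
Proof.
have [q' <-] := proj_surj q; have [x <-] := cls_surj q'.
have [c cE] := eS (incl _ x).
have /em[v vE] : 1⊗ (res_e (res B) i) (d _ n (n - 1) c) = 0.
  by rewrite -tensor_diff_map [1⊗ _ c]cE; exact: (kerpP _ _ (inclP x)).
have vZ : v \in tensor_cycles C (n - 1) _.
  apply/kerpP; apply: (inj_raddf0 (@mI B _)).
  by rewrite [LHS](esym (tensor_diff_map _ _ _)) vE tensor_diff_diff.
have [y yE] := subz_ex vZ.
have yK : cls _ (tensor_boundaries C (n - 1) _) y \in
    kerz (fmap (F (n - 1)) (res_m (res B) i)).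
  apply/kerpP; rewrite [LHS]subquot_mapE; apply/cls_eq0.
  by rewrite sub_mapE yE vE; apply/(tensor_boundariesP _ n1); exists c.
by have [s sE] := subz_ex yK; exists s, c, x, y; rewrite yE.
Qed.

Fact connecting_functional (B : lmodType R) s : @connecting B 0 s -> s = 0.
Proof.
case=> c [x [y [/esym/eqP + sE xE yE]]].
rewrite proj_eq0 => /impP[x1]; have [x' <-] := cls_surj x1.
rewrite [LHS]subquot_mapE => /eqP; rewrite -subr_eq0 -raddfB => /eqP/cls_eq0.
rewrite raddfB sub_mapE => /impP[w wE].
have [w' w'E] := eS w.
have /em[v vE] : 1⊗ (res_e (res B) i) (c - incl _ x' + d _ (n + 1) n w') = 0.
  rewrite raddfD raddfB -xE -tensor_diff_map [1⊗ _ w']w'E wE.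
  by rewrite addrA subrK subrr.
apply: (@Sincl_inj _ (F (n - 1)) _ (res B)); rewrite sE raddf0.
apply/cls_eq0/(tensor_boundariesP _ n1); exists v.
apply: (@mI B _); rewrite [LHS](esym (tensor_diff_map _ _ _)) vE raddfD raddfB.
rewrite tensor_diff_diff addr0 [d _ _ _ (incl _ x')](kerpP _ _ (inclP x')) subr0.
exact: esym yE.
Qed.

Fact connecting_surj (B : lmodType R) s : exists q, @connecting B q s.
Proof.
have [y yE] := cls_surj (Sincl _ _ _ s).
have : fmap (F (n - 1)) (res_m (res B) i) (cls _ _ y) = 0.
  by rewrite yE fmap_m_Sincl.
rewrite [LHS]subquot_mapE => /cls_eq0; rewrite sub_mapE.
move=> /(tensor_boundariesP _ n1)[c cE].
have xZ : 1⊗ (res_e (res B) i) c \in tensor_cycles C n _.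
  apply/kerpP; rewrite tensor_diff_map cE; apply/em.
  by exists (incl _ y).
have [x xE] := subz_ex xZ; exists (proj _ (cls _ _ x)), c, x, y.
by rewrite yE xE cE.
Qed.

Fact connecting_inj (B : lmodType R) q : @connecting B q 0 -> q = 0.
Proof.
case=> c [x [y [-> /esym + xE yE]]]; rewrite raddf0 => /cls_eq0.
move=> /(tensor_boundariesP _ n1)[v vE].
have cZ : c - 1⊗ (res_m (res B) i) v \in tensor_cycles C n _.
  by apply/kerpP; rewrite raddfB tensor_diff_map vE yE subrr.
have [x' x'E] := subz_ex cZ; apply/eqP; rewrite proj_eq0; apply/impP.
exists (cls _ _ x'); apply: homology_map_cls.
rewrite x'E raddfB -xE [X in _ - X](_ : _ = 0) ?subr0 //.
by apply/em; exists v.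
Qed.

Fact connecting_natural (M N : lmodType R) (f : {linear M -> N}) q s : @connecting M q s ->
  connecting (fmap (quot_stab_Om (F n) res i) f q)
    (fmap (left_satellite (F (n - 1)) res i.+1) f s).
Proof.
case=> c [x [y [-> sE xE yE]]].
pose l := reslift res f.
exists (1⊗ (lift_P l i) c), (sub_map (@tensor_homology_cycles _ C n _ _ (lift_Om l i)) x).
exists (sub_map (@tensor_homology_cycles _ C (n - 1) _ _ (lift_Om l i.+1)) y); split.
- by rewrite [LHS]quot_mapE [fmap _ _ _]subquot_mapE.
- apply: etrans (@SmapE _ (F (n - 1)) _ _ _ _ _ l i.+1 s) _.
  by rewrite sE [LHS]subquot_mapE.
- rewrite sub_mapE xE -!tensor_map_compr; congr (tensor_map _ _ c).
  by apply: linear_ext => z; exact: esym (lift_e l i z).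
rewrite sub_mapE tensor_diff_map -yE -!tensor_map_compr; congr (tensor_map _ _ (incl _ y)).
by apply: linear_ext => z; exact: lift_m l i z.
Qed.

Lemma stab_satellite_natiso :
  naturally_isomorphic (quot_stab_Om (F n) res i) (left_satellite (F (n - 1)) res i.+1).
Proof.
apply: (@natiso_of_relation _ (quot_stab_Om (F n) res i)
  (left_satellite (F (n - 1)) res i.+1) connecting).
- exact: connecting_sub.
- exact: connecting_total.
- exact: connecting_functional.
- exact: connecting_surj.
- exact: connecting_inj.
exact: connecting_natural.
Qed.
End Connecting.
End FlatComplex.

Section HomologyTensor.
Variable n : int.

Let Z : lmodType R^c := subz (cycles C n).
Let iZ : {linear Z -> C n} := linincl (cycles C n).
Let pZ : {linear Z -> homology C n} :=
  linproj (Submodule (restrp_submod (cycles C n) (boundaries C n))).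

Fact boundary_cycle x : diff C (n + 1) n x \in smod_zmod (cycles C n).
Proof. by apply/kerpP; exact: diff_comp. Qed.
Let dZ : {linear C (n + 1) -> Z} := lincorestrict boundary_cycle.

Fact diff_imm x : diff C n (n - 1) x \in smod_zmod (imm (diff C n (n - 1))).
Proof. by apply/impP; exists x. Qed.
Let qB := lincorestrict diff_imm.

Fact pZ_surj y : exists x, pZ x = y. Proof. exact: proj_surj. Qed.

Fact dZ_pZ_exact : exact_at dZ pZ.
Proof.
move=> z; split=> [/linproj_eq0/impP[x xE]|[x <-]].
  by exists x; apply: (@incl_inj _ (cycles C n)); exact: etrans (lincorestrictE _ _) xE.
apply/linproj_eq0/impP; exists x; exact: esym (lincorestrictE boundary_cycle x).
Qed.

Fact qB_surj y : exists x, qB x = y.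
Proof.
have /impP[x xE] := inclP y; exists x; apply: incl_inj.
exact: etrans (lincorestrictE _ _) xE.
Qed.

Fact iZ_qB_exact : exact_at iZ qB.
Proof.
move=> x; split=> [x0|[z <-]].
  have : x \in smod_zmod (cycles C n).
    apply/kerpP; apply: etrans (esym (lincorestrictE diff_imm x)) _.
    by rewrite [lincorestrict _ x]x0 raddf0.
  by case/subz_ex=> z zE; exists z.
apply: incl_inj; apply: etrans (lincorestrictE _ _) _.
by apply: etrans (kerpP _ _ (inclP z)) _; rewrite raddf0.
Qed.

Fact tensor_iZ_dZ M w : tensor_map iZ idfun (tensor_map dZ idfun w) = d M (n + 1) n w.
Proof.
rewrite -tensor_map_comp; congr (tensor_map _ _ w).
- by apply: linear_ext => x; exact: lincorestrictE.
exact: linear_ext.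
Qed.

Fact tensor_diff_iZ M z : d M n (n - 1) (tensor_map iZ idfun z) = 0.
Proof.
move: z; apply: (tensor_ext (f := d M n (n - 1) \o tensor_map iZ idfun) (g := \0)).
by move=> a m; rewrite /= !tensor_mapE (kerpP _ _ (inclP a)) tens0l.
Qed.

(* The graph of the map H_n(C) ⊗ M -> H_n(C ⊗ M), [z] ⊗ m |-> [z ⊗ m]. *)
Definition kunneth (M : lmodType R) (u : tensor (homology C n) M) (v : F n M) :=
  exists z y, [/\ u = tensor_map pZ idfun z, v = cls _ _ y & incl _ y = tensor_map iZ idfun z].

Let idS (M : lmodType R) (m : M) : exists x, idfun x = m := ex_intro _ m erefl.

Lemma tensor_homology_natTrans :
  exists t : natTrans (tensor_functor (homology C n)) (F n),
    forall M u v, kunneth u v <-> t M u = v.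
Proof.
apply: (@natTrans_of_relation _ (tensor_functor (homology C n)) (F n) kunneth).
- move=> M _ _ _ _ [z [y [-> -> yE]]] [z' [y' [-> -> y'E]]].
  by exists (z - z'), (y - y'); rewrite !raddfB yE y'E.
- move=> M u; have [z <-] := tensor_map_surj pZ_surj (@idS M) u.
  have : tensor_map iZ idfun z \in tensor_cycles C n M.
    by apply/kerpP; exact: tensor_diff_iZ.
  by case/subz_ex=> y yE; exists (cls _ _ y), z, y.
- move=> M _ [z [y [/esym/(tensor_exactl pZ_surj dZ_pZ_exact)[w <-] -> yE]]].
  by apply/cls_eq0; rewrite yE tensor_iZ_dZ; apply/impP; exists w.
move=> M N f _ _ [z [y [-> -> yE]]].
exists (1⊗ f z), (sub_map (tensor_homology_cycles f) y).
split; [exact: esym (tensor_map_xchg _ _ _) | exact: subquot_mapE |].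
by rewrite sub_mapE yE tensor_map_xchg.
Qed.

Lemma derived_homology_natiso (res : forall B : lmodType R, resolution B) i :
  naturally_isomorphic (left_derived (F n) res i) (Tor res i (homology C n)).
Proof.
have [t tP] := tensor_homology_natTrans.
apply/natiso_sym/(left_derived_natiso (t := t)) => P Pproj.
have iZI := projective_flat Pproj (@incl_inj _ (cycles C n) : injective iZ).
apply: inj_surj_bijective => [|v].
  apply: raddf_inj0 => u /tP[z [y [-> /esym/cls_eq0/impP[w wE] yE]]].
  apply/(tensor_exactl pZ_surj dZ_pZ_exact); exists w.
  by apply: iZI; rewrite tensor_iZ_dZ -yE.
have [y <-] := cls_surj v.
have /(tensor_exactl qB_surj iZ_qB_exact)[z zE] : tensor_map qB (@idfun P) (incl _ y) = 0.
  have jI := projective_flat Pproj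
    (@incl_inj _ (imm (diff C n (n - 1))) : injective (linincl _)).
  apply: (inj_raddf0 jI); rewrite -tensor_map_comp.
  apply: etrans (kerpP _ _ (inclP y)); congr (tensor_map _ _ (incl _ y)).
    by apply: linear_ext => x; exact: lincorestrictE.
  exact: linear_ext.
by exists (tensor_map pZ idfun z); apply/tP; exists z, y.
Qed.
End HomologyTensor.
End Complex.

Theorem mainTheorem8 (R : pzRingType) (C : chain_complex R^c)
    (C_flat : forall k : int, flat (C k)) (n : int)
    (res : forall B : lmodType R, resolution B) :
  let F : addFunctor R := tensor_homology_functor C n in
  [/\ left_fundamental_sequence_exact F res,
      forall i : nat, naturally_isomorphic (quot_stab_Om F res i)
        (Tor res i.+1 (chain_mod_boundaries C (n - 1))),
      forall i : nat, naturally_isomorphic (left_derived F res i)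
        (Tor res i (homology C n)),
      naturally_isomorphic (left_derived F res 0)
        (tensor_functor (homology C n)) &
      forall i : nat, (0 < i)%N -> naturally_isomorphic (left_satellite F res i)
        (Tor res i (chain_mod_boundaries C n))].
Proof.
split=> [|i|i||[|i] // _].
- exact/half_exact_fundamental_sequence/tensor_homology_half_exact.
- exact: natiso_trans (stab_satellite_natiso _ _ _ _) (satellite_homology_natiso _ _ _ _).
- exact: derived_homology_natiso.
- apply: natiso_trans (derived_homology_natiso _ _ _ _) _.
  exact: natiso_trans (Tor_satellite_natiso _ _ _) (satellite0_natiso _ _).
exact: satellite_homology_natiso.
Qed.
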